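(* For $0<\alpha<\infty$ let $\lambda_1(K_\alpha)>\lambda_2(K_\alpha)>\cdots>\frac{2}{\alpha}$ be the eigenvalues of $K_\alpha$ listed in decreasing order, and let $N(K_\alpha)$ be the total number of eigenvalues of $K_\alpha$. Write $\lambda_j(\alpha K_\alpha)=\alpha\lambda_j(K_\alpha)$. Then: (i) For every fixed $j\geq 1$, the function $\alpha\mapsto\lambda_j(\alpha K_\alpha)$ (defined for those $\alpha$ with $N(K_\alpha)\geq j$) is increasing. (ii) The function $\alpha\mapsto N(K_\alpha)$, $\alpha\in(0,\infty)$, is non-decreasing and unbounded. (iii) For every fixed $j\geq1$, as $\alpha\to\infty$, it holds that $\lambda_j(K_\alpha)=j^{-1}+O(\alpha^{-1})$.
   Context: For $\alpha>0$, $K_\alpha$ denotes the bounded self-adjoint operator on $\ell^2(\mathbb{N})$, $\mathbb{N}=\{1,2,3,\ldots\}$, given by the infinite matrix \[K_\alpha=\left(\frac{(nm)^{-\frac12+\alpha}}{[\max(n,m)]^{2\alpha}}\right)_{n,m=1}^\infty .\] It is known that $K_\alpha$ has finitely many (possibly no) eigenvalues, that all of them are simple, and that all of them lie in $(\tfrac{2}{\alpha},\infty)$; hence the enumeration in the claim makes sense (it is a finite, possibly empty, list) and $N(K_\alpha)$ is a non-negative integer. *)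

(* Defs.v *)
From HB Require Import structures.
From mathcomp Require Import all_boot all_order all_algebra finmap.
From mathcomp Require Import all_classical all_reals all_analysis.
From mathcomp Require Export complex.
Set Implicit Arguments.
Unset Strict Implicit.
Unset Printing Implicit Defensive.
Import Order.TTheory GRing.Theory Num.Theory.
Import numFieldNormedType.Exports.
Local Open Scope classical_set_scope.
Local Open Scope ring_scope.
Local Open Scope complex_scope.

(* The scalar field of l^2(N) is the field R[i] of complex numbers over R.
   Sequences are indexed from 0, so index n : nat stands for the positive
   integer n.+1 throughout. *)

Definition Kmx (R : realType) (a : R) (n m : nat) : R :=
  ((n.+1 * m.+1)%N%:R `^ (- 2^-1 + a)) / ((maxn n.+1 m.+1)%:R `^ (2 * a)).

Definition l2 (R : realType) : set (nat -> R[i]) :=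
  [set x | cvgn (series (fun n => ComplexField.Normc.normc (x n) ^+ 2) : R^nat)].

(* Kmaps a x y : "K_a x = y", each coordinate of y being the sum of the
   (convergent) series sum_m K_a(n, m) x_m. The alias R[i]^o is where R[i]
   carries its norm topology. *)
Definition Kmaps (R : realType) (a : R) (x y : nat -> R[i]) : Prop :=
  forall n, series (fun m => (Kmx a n m)%:C * x m : R[i]^o) @ \oo --> (y n : R[i]^o).

(* The point spectrum, as a set of reals: K_a is self-adjoint, so that it has
   no other eigenvalues. *)
Definition eigenvalues (R : realType) (a : R) : set R :=
  [set l | exists x : nat -> R[i],
    [/\ l2 x, exists n, x n != 0 & Kmaps a x (fun n => l%:C * x n)]].

(* For a > 0 the set [eigenvalues a] is finite and every eigenvalue is simple,
   so distinct eigenvalues are what is enumerated and counted. ([fset_set] of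
   an infinite set would be empty; for a > 0 that case does not occur.) *)
Definition eigenvalue_list (R : realType) (a : R) : seq R :=
  sort >=%O (fset_set (eigenvalues a)).

Definition N_eig (R : realType) (a : R) : nat := size (eigenvalue_list a).

(* The j-th largest eigenvalue, counted from j = 1; meaningful only when
   1 <= j <= N_eig a, and 0 for j > N_eig a. *)
Definition eig (R : realType) (j : nat) (a : R) : R :=
  nth 0 (eigenvalue_list a) j.-1.

(* Main.v *)
Require Import Defs.
From HB Require Import structures.
From mathcomp Require Import all_boot all_order all_algebra finmap.
From mathcomp Require Import all_classical all_reals all_analysis.
From mathcomp Require Import ring lra.
Set Implicit Arguments.
Unset Strict Implicit.
Unset Printing Implicit Defensive.
Import Order.TTheory GRing.Theory Num.Theory.
Import numFieldNormedType.Exports.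
Local Open Scope classical_set_scope.
Local Open Scope ring_scope.

(** Write N = n + 1 for the integer attached to an index n, and put
    v_N = N^(-1/2-a), w_N = N^(2a), w_0 = 0. Then K_a(N, M) is
    v_N v_M min(w_N, w_M), a Green matrix. With the weighted tail sums
    S_k = sum_(M >= k) v_M x_M one gets

      (K_a x)_N = v_N sum_(k <= N) (w_k - w_(k-1)) S_k,
      <K_a x, x> = sum_k (w_k - w_(k-1)) S_k^2,

    so K_a is the adjoint of the discrete Hardy operator [hardy_op] times that
    operator, and the eigenvalue equation is a second-order recurrence
    for S in which the first coordinate of x determines the rest: eigenvalues
    are simple. Three facts about the quadratic form [qform] carry the proof.

    The threshold 2/a. A Riccati sequence of the form N^(2a) (2 - N^(-1/2))
    shows that [qform] is at most (2/a) |x|^2 up to finitely many of the S_k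
    ([riccati_step], [hardy]). Hence there are finitely many eigenvalues above
    2/a ([finitely_many]). Moreover the supremum of the Rayleigh quotient on the
    orthogonal complement of finitely many eigenvectors is attained when it
    exceeds 2/a, because a maximising sequence cannot then tend weakly to zero
    ([exists_maximizer]); so a j-dimensional space on which the form exceeds
    c |x|^2 with c >= 2/a produces j eigenvalues above c
    ([variational_lower_bound]). Conversely no eigenvalue is at most 2/a
    ([eigenvalue_above_threshold]): in scaled variables the recurrence is an
    O(1/N^2) perturbation of a linear Hamiltonian flow with time log N, which
    for such eigenvalues has no decaying solution.

    Monotonicity in the parameter. The inverse form
    Q_a(x) = sum_N (y_N - y_(N-1))^2 / (w_N - w_(N-1)), y_N = N^(1/2+a) x_N,
    divided by a, is a sum of squares of terms independent of a with
    coefficients 1/a, coth(u)/a and tanh(u)/a, where u = (a/2) log(1 + 1/N)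
    ([inv_form_hyperbolic]); these decrease in a ([inv_form_antitone]). The
    Cauchy-Schwarz inequality |x|^4 <= Q_b(x) <K_b x, x>
    ([ip_sq_le_inv_form]) turns the bound on Q_a over the span of the first j
    eigenvectors of K_a into a lower bound for b K_b on the same span, strictly
    above a lambda_j(K_a) ([eig_compare]). This gives (i), and also that the
    number of eigenvalues does not decrease.

    Large parameters. By Schur's test K_a differs from the diagonal matrix
    with entries 1/N by at most 3/a in norm ([schur_fin]). Testing on the
    first j coordinate vectors, and on a combination of j eigenvectors whose
    first j - 1 coordinates vanish, puts lambda_j between 1/j - 4/a and
    1/j + 3/a ([eig_lower], [eig_upper]); in particular the j-th eigenvalue
    exists as soon as a >= 6j. *)

(** * Square-summable real sequences *)

Section SquareSummable.
Variable R : realType.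
Implicit Types (x y z h : nat -> R) (c : R) (n : nat).

(** Bounded partial sums rather than convergence: this form is stable under
    pointwise limits, and makes every membership proof a finite estimate. *)
Definition sqsum x := exists B, forall n, \sum_(k < n) x k ^+ 2 <= B.

Definition ip x y := limn (fun n => \sum_(k < n) x k * y k).

Lemma nneg_sum_cvg (u : nat -> R) B : (forall k, 0 <= u k) ->
  (forall n, \sum_(k < n) u k <= B) -> cvgn (fun n => \sum_(k < n) u k).
Proof.
move=> u0 uB; apply: nondecreasing_is_cvgn.
  apply/nondecreasing_seqP => n.
  by rewrite big_ord_recr /= lerDl.
by exists B => _ [n _ <-].
Qed.

Lemma sqsumD x y : sqsum x -> sqsum y -> sqsum (x + y).
Proof.
move=> [B xB] [C yC]; exists (2 * B + 2 * C) => n.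
rewrite (le_trans (y := \sum_(k < n) (2 * x k ^+ 2 + 2 * y k ^+ 2)))//.
  apply: ler_sum => k _ /=.
  have -> : (x + y) k = x k + y k by [].
  have := sqr_ge0 (x k - y k); nra.
rewrite big_split /= -!mulr_sumr.
by have := xB n; have := yC n; lra.
Qed.

Lemma sqsumZ c x : sqsum x -> sqsum (c *: x).
Proof.
move=> [B xB]; exists (c ^+ 2 * B) => n.
under eq_bigr do rewrite exprMn.
by rewrite -mulr_sumr ler_wpM2l// sqr_ge0.
Qed.

Lemma sqsum0 : sqsum 0.
Proof. by exists 0 => n; rewrite big1// => k _; rewrite expr0n. Qed.

Lemma sqsumB x y : sqsum x -> sqsum y -> sqsum (x - y).
Proof. by move=> sx sy; rewrite -scaleN1r; apply/sqsumD/sqsumZ. Qed.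

Lemma sqsum_sum j (c : 'I_j -> R) (f : 'I_j -> nat -> R) :
  (forall i, sqsum (f i)) -> sqsum (\sum_(i < j) c i *: f i).
Proof.
move=> sf; elim/big_ind : _ => //; first exact: sqsum0.
  by move=> *; exact: sqsumD.
by move=> i _; exact: sqsumZ.
Qed.

(** Polarisation reduces the convergence to that of two series with
    nonnegative terms. *)
Lemma ip_cvg x y : sqsum x -> sqsum y ->
  (fun n => \sum_(k < n) x k * y k) @ \oo --> ip x y.
Proof.
move=> sx sy.
have sc z : sqsum z -> cvgn (fun n => \sum_(k < n) z k ^+ 2).
  by move=> [B zB]; apply: (@nneg_sum_cvg (fun k => z k ^+ 2) B) => // k;
    exact: sqr_ge0.
have /sc cD := sqsumD sx sy; have /sc cB := sqsumB sx sy.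
suff : cvgn (fun n => \sum_(k < n) x k * y k) by [].
have -> : (fun n => \sum_(k < n) x k * y k) =
  (fun n => 4^-1 * (\sum_(k < n) (x + y) k ^+ 2 - \sum_(k < n) (x - y) k ^+ 2)).
  apply/funext => n; rewrite -sumrB mulr_sumr; apply: eq_bigr => k _.
  have -> : (x + y) k = x k + y k by [].
  have -> : (x - y) k = x k - y k by [].
  by field.
apply/cvg_ex; eexists; apply: cvgMl_tmp; apply: cvgB; [exact: cD|exact: cB].
Qed.

Lemma ip_unique x y l :
  (fun n => \sum_(k < n) x k * y k) @ \oo --> l -> ip x y = l.
Proof. by move=> /cvg_lim; exact. Qed.

Lemma ipC x y : ip x y = ip y x.
Proof.
by congr (limn _); apply/funext => n; apply: eq_bigr => k _; rewrite mulrC.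
Qed.

Lemma ipDl x y z : sqsum x -> sqsum y -> sqsum z ->
  ip (x + y) z = ip x z + ip y z.
Proof.
move=> sx sy sz; apply: ip_unique.
under eq_fun do under eq_bigr do rewrite [(x + y) _]/(_ + _) mulrDl.
under eq_fun do rewrite big_split /=.
by apply: cvgD; exact: ip_cvg.
Qed.

Lemma ipZl c x z : sqsum x -> sqsum z -> ip (c *: x) z = c * ip x z.
Proof.
move=> sx sz; apply: ip_unique.
under eq_fun do under eq_bigr do rewrite [(c *: x) _]/(_ * _) -mulrA.
under eq_fun do rewrite -mulr_sumr.
by apply: cvgMl_tmp; exact: ip_cvg.
Qed.

Lemma ipDr x y z : sqsum x -> sqsum y -> sqsum z ->
  ip x (y + z) = ip x y + ip x z.
Proof. by move=> sx sy sz; rewrite ipC ipDl// !(ipC x). Qed.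

Lemma ipZr c x z : sqsum x -> sqsum z -> ip x (c *: z) = c * ip x z.
Proof. by move=> sx sz; rewrite ipC ipZl// ipC. Qed.

Lemma ip0l x : ip 0 x = 0.
Proof.
apply: ip_unique.
rewrite (_ : (fun n => _) = (fun=> 0)); first exact: cvg_cst.
by apply/funext => n; rewrite big1// => k _; rewrite mul0r.
Qed.

Lemma ip_suml j (c : 'I_j -> R) (f : 'I_j -> nat -> R) h :
  (forall i, sqsum (f i)) -> sqsum h ->
  ip (\sum_(i < j) c i *: f i) h = \sum_(i < j) c i * ip (f i) h.
Proof.
move=> sf sh; suff [] : sqsum (\sum_(i < j) c i *: f i) /\
    ip (\sum_(i < j) c i *: f i) h = \sum_(i < j) c i * ip (f i) h by [].
elim/big_rec2 : _ => [|i y1 y2 _ [sy2 ipy2]]; first by split;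
  [exact: sqsum0|rewrite ip0l].
have sci : sqsum (c i *: f i) by exact: sqsumZ.
by split; [exact: sqsumD|rewrite ipDl// ipZl// ipy2].
Qed.

Lemma le_ip x n : sqsum x -> \sum_(k < n) x k ^+ 2 <= ip x x.
Proof.
move=> sx.
have := @nondecreasing_cvgn_le _ (fun n => \sum_(k < n) x k * x k) _ _ n.
rewrite (eq_bigr (fun k : 'I_n => x k ^+ 2)) => [|k _]; last by rewrite expr2.
apply; last exact/cvgP/ip_cvg.
by apply/nondecreasing_seqP => m; rewrite big_ord_recr /= lerDl -expr2 sqr_ge0.
Qed.

Lemma ip_le x B : sqsum x -> (forall n, \sum_(k < n) x k ^+ 2 <= B) ->
  ip x x <= B.
Proof.
move=> sx xB; apply: limr_le; first exact/cvgP/ip_cvg.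
by near=> n; under eq_bigr do rewrite -expr2; exact: xB.
Unshelve. all: by end_near. Qed.

Lemma ip_ge0 x : sqsum x -> 0 <= ip x x.
Proof. by move=> /(le_ip 0); rewrite big_ord0. Qed.

Lemma ip_eq0 x : sqsum x -> ip x x <= 0 -> x = 0.
Proof.
move=> sx x0; apply/funext => n /=.
have := le_trans (le_ip n.+1 sx) x0; rewrite big_ord_recr /=.
have : 0 <= \sum_(k < n) x k ^+ 2 by apply: sumr_ge0 => k _; exact: sqr_ge0.
move=> s0 s1; have : x n ^+ 2 <= 0 by lra.
move=> x2; apply/eqP; rewrite -sqrf_eq0.
by rewrite eq_le x2 sqr_ge0.
Qed.

End SquareSummable.

(** * Cauchy-Schwarz, tails and weak limits *)

Section CauchySchwarz.
Variable R : realType.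
Implicit Types (x y z h : nat -> R) (c : R) (n : nat).

(** The discriminant criterion; the hypothesis that the leading coefficient is
    nonnegative lets the degenerate case be treated by a single test point. *)
Lemma quad_disc (a b c : R) : 0 <= c ->
  (forall t, 0 <= a + 2 * t * b + t ^+ 2 * c) -> b ^+ 2 <= a * c.
Proof.
move=> c0 H; have a0 : 0 <= a by have := H 0; rewrite mulr0 mul0r expr0n mul0r !addr0.
have [c_gt0|] := ltP 0 c; last first.
  move=> c1; have -> : c = 0 by apply/eqP; rewrite eq_le c0 c1.
  rewrite mulr0; have [->|b0] := eqVneq b 0; first by rewrite expr0n.
  (* the affine function a + 2 t b takes the value -1 here *)
  have := H (- (a + 1) / (2 * b)).
  have -> : a + 2 * (- (a + 1) / (2 * b)) * b + (- (a + 1) / (2 * b)) ^+ 2 * c =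
    -1 + (- (a + 1) / (2 * b)) ^+ 2 * c by field.
  have -> : c = 0 by apply/eqP; rewrite eq_le c0 c1.
  by rewrite mulr0 addr0; lra.
have := H (- b / c).
have -> : a + 2 * (- b / c) * b + (- b / c) ^+ 2 * c = (a * c - b ^+ 2) / c.
  by field; rewrite gt_eqF.
by rewrite pmulr_lge0 ?invr_gt0// subr_ge0.
Qed.

Lemma sum_CS (u w : nat -> R) n :
  (\sum_(k < n) u k * w k) ^+ 2 <=
  (\sum_(k < n) u k ^+ 2) * \sum_(k < n) w k ^+ 2.
Proof.
apply: quad_disc => [|t]; first by apply: sumr_ge0 => k _; exact: sqr_ge0.
have -> : \sum_(k < n) u k ^+ 2 + 2 * t * (\sum_(k < n) u k * w k) +
  t ^+ 2 * (\sum_(k < n) w k ^+ 2) = \sum_(k < n) (u k + t * w k) ^+ 2.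
  by rewrite !mulr_sumr -!big_split /=; apply: eq_bigr => k _; ring.
by apply: sumr_ge0 => k _; exact: sqr_ge0.
Qed.

Lemma ip_expand x y (t : R) : sqsum x -> sqsum y ->
  ip (x + t *: y) (x + t *: y) = ip x x + 2 * t * ip x y + t ^+ 2 * ip y y.
Proof.
move=> sx sy; have sty : sqsum (t *: y) by exact: sqsumZ.
rewrite ipDl ?ipDr ?ipZl ?ipZr//; last exact: sqsumD.
by rewrite (ipC y x); ring.
Qed.

Lemma ip_parallelogram x y : sqsum x -> sqsum y ->
  ip (x + y) (x + y) + ip (x - y) (x - y) = 2 * ip x x + 2 * ip y y.
Proof.
move=> sx sy; rewrite -[in X in X + _ = _](scale1r y) -(scaleN1r y).
by rewrite !ip_expand//; ring.
Qed.

Lemma ip_CS x y : sqsum x -> sqsum y -> (ip x y) ^+ 2 <= ip x x * ip y y.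
Proof.
move=> sx sy; apply: quad_disc => [|t]; first exact: ip_ge0.
by rewrite -ip_expand//; apply/ip_ge0/sqsumD/sqsumZ.
Qed.

Definition tailseq (N : nat) x : nat -> R := fun m => if (N <= m)%N then x m else 0.

Lemma sqsum_tailseq N x : sqsum x -> sqsum (tailseq N x).
Proof.
move=> [B xB]; exists B => n; apply: le_trans (xB n).
apply: ler_sum => k _; rewrite /tailseq; case: ifPn => // _.
by rewrite expr0n sqr_ge0.
Qed.

Lemma sum_tailseq N n x y : (N <= n)%N ->
  \sum_(k < n) tailseq N x k * y k = \sum_(k < n) x k * y k - \sum_(k < N) x k * y k.
Proof.
move=> /subnKC <-; elim: (n - N)%N => [|m IH].
  rewrite addn0 subrr big1// => k _.
  by rewrite /tailseq leqNgt ltn_ord mul0r.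
by rewrite addnS !big_ord_recr /= IH /tailseq leq_addr addrAC.
Qed.

Lemma ip_tailseq N x y : sqsum x -> sqsum y ->
  ip (tailseq N x) y = ip x y - \sum_(k < N) x k * y k.
Proof.
move=> sx sy; apply: ip_unique.
apply: cvg_trans (cvgB (ip_cvg sx sy) (cvg_cst (\sum_(k < N) x k * y k))).
by apply: near_eq_cvg; exists N => // n /= Nn; rewrite sum_tailseq.
Qed.

Lemma tailseqM N x y k : tailseq N x k * y k = x k * tailseq N y k.
Proof. by rewrite /tailseq; case: ifP; rewrite ?mul0r ?mulr0. Qed.

(** Cutting off the head is a self-adjoint projection. *)
Lemma ip_tailseqr N x y : ip (tailseq N x) y = ip x (tailseq N y).
Proof.
by congr (limn _); apply/funext => n; apply: eq_bigr => k _; rewrite tailseqM.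
Qed.

Lemma tailseq_idem N x : tailseq N (tailseq N x) = tailseq N x.
Proof. by apply/funext => k; rewrite /tailseq; case: ifP => // ->. Qed.

Lemma ip_tailseq2 N x : sqsum x ->
  ip (tailseq N x) (tailseq N x) = ip x x - \sum_(k < N) x k ^+ 2.
Proof.
move=> sx; rewrite ip_tailseqr tailseq_idem -ip_tailseqr ip_tailseq//.
Qed.

Lemma ip_tailseq_cvg0 x : sqsum x ->
  (fun N => ip (tailseq N x) (tailseq N x)) @ \oo --> (0 : R).
Proof.
move=> sx; rewrite -(subrr (ip x x)).
under eq_fun do rewrite ip_tailseq2//.
apply: cvgB; first exact: cvg_cst.
by under eq_fun do under eq_bigr do rewrite expr2; exact: ip_cvg.
Qed.

Definition unit_seq n : nat -> R := fun m => (m == n)%:R.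

Lemma sum_unit n N x :
  \sum_(k < N) x k * unit_seq n k = if (n < N)%N then x n else 0.
Proof.
elim: N => [|N IH]; first by rewrite big_ord0.
rewrite big_ord_recr /= IH /unit_seq ltnS (leq_eqVlt n) (eq_sym n).
by case: eqVneq => [->|]; rewrite ?ltnn ?mulr1 ?mulr0 ?addr0 ?add0r.
Qed.

Lemma sqsum_unit n : sqsum (unit_seq n).
Proof.
exists 1 => N; under eq_bigr do rewrite expr2.
by rewrite sum_unit; case: ifP => // _; rewrite /unit_seq eqxx.
Qed.

Lemma ip_unit n x : ip x (unit_seq n) = x n.
Proof.
have H : (fun=> x n) @ \oo --> x n by exact: cvg_cst.
apply: ip_unique; apply: cvg_trans H.
by apply: near_eq_cvg; exists n.+1 => // N /= nN; rewrite sum_unit nN.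
Qed.

Lemma cvg_ord_sum {T : Type} {F : set_system T} {FF : Filter F} n
    (f : 'I_n -> T -> R) (l : 'I_n -> R) :
  (forall k, f k t @[t --> F] --> l k) ->
  \sum_(k < n) f k t @[t --> F] --> \sum_(k < n) l k.
Proof. by move=> fl; apply: cvg_big => //; exact: add_continuous. Qed.

Section WeakLimit.
Context {T : Type} {F : set_system T} {FF : ProperFilter F}.
Variables (u : T -> nat -> R) (B : R) (x : nat -> R).
Hypothesis su : forall t, sqsum (u t).
Hypothesis uB : forall t, ip (u t) (u t) <= B.
Hypothesis ux : forall n, u t n @[t --> F] --> x n.

Lemma weak_limit_le n : \sum_(k < n) x k ^+ 2 <= B.
Proof.
apply: (@cvgr_to_le _ F _ _ (fun t => \sum_(k < n) u t k ^+ 2)).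
  apply: cvg_ord_sum => k; under eq_fun do rewrite expr2.
  by rewrite expr2; exact: cvgM.
by near=> t; exact: le_trans (le_ip n (su t)) (uB t).
Unshelve. all: by end_near. Qed.

Lemma weak_limit_sqsum : sqsum x.
Proof. by exists B; exact: weak_limit_le. Qed.

(** A bounded family that converges coordinatewise converges weakly: the head
    of h sees finitely many coordinates, and its tail has small norm. The filter
    is arbitrary so that the lemma applies along an ultrafilter. *)
Lemma weak_limit_ip h : sqsum h -> ip (u t) h @[t --> F] --> ip x h.
Proof.
move=> sh; have sx := weak_limit_sqsum.
have xxB : ip x x <= B by apply: ip_le => //; exact: weak_limit_le.
have sd t : sqsum (u t - x) by exact: sqsumB.
have dB t : ip (u t - x) (u t - x) <= 4 * B.
  have := ip_parallelogram (su t) sx.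
  by have := uB t; have := ip_ge0 (sqsumD (su t) sx); lra.
have B0 : 0 <= B by exact: le_trans (ip_ge0 sx) _.
apply/cvgrPdist_lt => e e0.
have /cvgrPdist_lt/(_ (e ^+ 2 / (16 * B + 16))) := ip_tailseq_cvg0 sh.
case; first by rewrite divr_gt0 ?exprn_gt0//; lra.
move=> N _ /(_ N (leqnn N)) /=; rewrite sub0r normrN ger0_norm; last first.
  exact/ip_ge0/sqsum_tailseq.
have p16 : 0 < 16 * B + 16 by lra.
rewrite ltr_pdivlMr//.
set q := ip (tailseq N h) _ => qe.
have q0 : 0 <= q by exact/ip_ge0/sqsum_tailseq.
have : \sum_(k < N) u t k * h k @[t --> F] --> \sum_(k < N) x k * h k.
  by apply: cvg_ord_sum => k; apply: cvgM; [exact: ux|exact: cvg_cst].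
move=> /cvgrPdist_lt/(_ (e / 2)) /=; rewrite divr_gt0// => /(_ isT) H.
near=> t.
have -> : ip x h - ip (u t) h =
    (\sum_(k < N) x k * h k - \sum_(k < N) u t k * h k) - ip (u t - x) (tailseq N h).
  rewrite -ip_tailseqr ip_tailseq// -(scaleN1r x) ipDl//; last exact: sqsumZ.
  rewrite ipZl//.
  have -> : \sum_(k < N) (u t + -1 *: x) k * h k =
      \sum_(k < N) u t k * h k - \sum_(k < N) x k * h k.
    rewrite -sumrB; apply: eq_bigr => k _.
    by have -> : (u t + -1 *: x) k = u t k + -1 * x k by []; ring.
  by ring.
apply: le_lt_trans (ler_normB _ _) _.
have H1 : `|\sum_(k < N) x k * h k - \sum_(k < N) u t k * h k| < e / 2.
  by near: t.
have H2 : `|ip (u t - x) (tailseq N h)| <= e / 2.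
  rewrite -(@ler_pXn2r _ 2)// ?nnegrE ?divr_ge0 ?(ltW e0)// real_normK ?num_real//.
  apply: le_trans (ip_CS (sd t) (sqsum_tailseq N sh)) _.
  rewrite -/q; have := dB t; have := ip_ge0 (sd t).
  by set p := ip _ _ => p0 pB; nra.
by lra.
Unshelve. all: by end_near. Qed.

End WeakLimit.

End CauchySchwarz.

(** * Powers of integers: expansions and increments *)

Section Powers.
Variable R : realType.
Implicit Types (al be t s : R) (n : nat).

(** Only the tangent inequality [expR_ge1Dx] is used, at s and at -s: it gives
    the lower bound, and expR s <= 1 / (1 - s) for the upper one. *)
Lemma expR_second_order s : `|s| <= 2^-1 -> `|expR s - 1 - s| <= 2 * s ^+ 2.
Proof.
rewrite ler_norml => /andP[s1 s2].
have e1 : 1 + s <= expR s by exact: expR_ge1Dx.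
have e2 : 1 - s <= expR (- s) by exact: expR_ge1Dx.
have e3 : expR s * expR (- s) = 1 by rewrite -expRD subrr expR0.
have e4 : 0 < expR s by exact: expR_gt0.
have e5 : expR s * (1 - s) <= 1 by rewrite -[leRHS]e3 ler_pM2l.
rewrite ger0_norm; last lra.
nra.
Qed.

(** The lower bound is the tangent inequality applied to
    1 / (1 + t) = 1 - t / (1 + t). *)
Lemma ln1D_second_order t : `|t| <= 2^-1 -> `|ln (1 + t) - t| <= 2 * t ^+ 2.
Proof.
rewrite ler_norml => /andP[t1 t2].
have p : 0 < 1 + t by lra.
have l1 : ln (1 + t) <= t.
  by rewrite -ler_expR lnK ?posrE//; exact: expR_ge1Dx.
have l2 : t / (1 + t) <= ln (1 + t).
  rewrite -ler_expR lnK ?posrE//.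
  have := expR_ge1Dx (- (t / (1 + t))).
  have -> : 1 + - (t / (1 + t)) = (1 + t)^-1 by field; rewrite gt_eqF.
  rewrite expRN lef_pV2 ?posrE//; exact: expR_gt0.
have l3 : t / (1 + t) = t - t ^+ 2 / (1 + t) by field; rewrite gt_eqF.
have l4 : t ^+ 2 / (1 + t) <= 2 * t ^+ 2.
  rewrite ler_pdivrMr//; have := sqr_ge0 t; nra.
rewrite ler0_norm; lra.
Qed.

(** Stated for a real exponent of either sign: negative exponents supply the
    expansion of inverse ratios. *)
Lemma powR1D_second_order be : exists K e : R, [/\ 0 < K, 0 < e &
  forall t, `|t| <= e -> `|(1 + t) `^ be - 1 - be * t| <= K * t ^+ 2].
Proof.
(* |ln (1 + t)| <= 2 |t| gives |s| <= 2 |be| |t| <= 1/2, and the error is at most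
   2 s^2 + 2 |be| t^2 *)
exists (8 * be ^+ 2 + 2 * `|be| + 1), (4 * `|be| + 4)^-1.
have b0 := normr_ge0 be.
have b2 : be ^+ 2 = `|be| ^+ 2 by rewrite real_normK// num_real.
split; [by have := sqr_ge0 be; lra|by rewrite invr_gt0; lra|].
move=> t te.
have q0 : 0 < 4 * `|be| + 4 by lra.
have tq : `|t| * (4 * `|be| + 4) <= 1 by rewrite -ler_pdivlMr// div1r.
have t0 := normr_ge0 t.
have t4 : `|t| <= 4^-1 by nra.
have t2 : `|t| <= 2^-1 by lra.
have tt : t ^+ 2 = `|t| ^+ 2 by rewrite real_normK// num_real.
have p : 0 < 1 + t by move: t2; rewrite ler_norml => /andP[]; lra.
have lnb := ln1D_second_order t2.
rewrite /powR gt_eqF//; set s := be * ln (1 + t).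
have lns : `|ln (1 + t)| <= 2 * `|t|.
  have -> : ln (1 + t) = (ln (1 + t) - t) + t by ring.
  by apply: le_trans (ler_normD _ _) _; nra.
have sle : `|s| <= 2 * `|be| * `|t| by rewrite normrM; nra.
have s2 : `|s| <= 2^-1 by nra.
have s3 : s ^+ 2 <= 4 * be ^+ 2 * t ^+ 2.
  have -> : s ^+ 2 = `|s| ^+ 2 by rewrite real_normK// num_real.
  rewrite b2 tt; have := normr_ge0 s; nra.
have -> : expR s - 1 - be * t = (expR s - 1 - s) + be * (ln (1 + t) - t).
  by rewrite /s; ring.
apply: le_trans (ler_normD _ _) _; rewrite normrM.
have := expR_second_order s2.
have : `|be| * `|ln (1 + t) - t| <= `|be| * (2 * t ^+ 2) by rewrite ler_wpM2l.
have := sqr_ge0 t; nra.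
Qed.

Definition npow al n : R := n%:R `^ al.

Lemma npow0 al : 0 < al -> npow al 0 = 0.
Proof. by move=> al0; rewrite /npow powR0// gt_eqF. Qed.

Lemma npow1 al : npow al 1 = 1. Proof. by rewrite /npow powR1. Qed.

Lemma npow_gt0 al n : 0 < npow al n.+1.
Proof. by rewrite /npow powR_gt0// ltr0n. Qed.

Lemma npow_ge0 al n : 0 <= npow al n. Proof. exact: powR_ge0. Qed.

Lemma npow_lt al m n : 0 < al -> (m < n)%N -> npow al m < npow al n.
Proof.
by move=> al0 mn; rewrite /npow gt0_ltr_powR// ?nnegrE ?ler0n// ltr_nat.
Qed.

Lemma npow_le al m n : 0 < al -> (m <= n)%N -> npow al m <= npow al n.
Proof. by move=> al0; rewrite leq_eqVlt => /predU1P[->//|/(npow_lt al0)/ltW]. Qed.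

Lemma npow_double al n : npow (2 * al) n = npow al n ^+ 2.
Proof. by rewrite /npow -powR_mulrn ?powR_ge0// -powRrM mulrC. Qed.

Lemma npow_ratio al m n : npow al m.+1 / npow al n.+1 = (m.+1%:R / n.+1%:R) `^ al.
Proof. by rewrite /npow powRM ?ler0n ?invr_ge0// -(powR_inv1 (ler0n _ _)) -powRrM
  mulN1r powRN. Qed.

(** From ln ((N + 1) / N) >= 1 / (N + 1), that is -ln (1 - t) >= t. *)
Lemma npow_ratio_ge be n : 0 < be ->
  1 + be / n.+2%:R <= npow be n.+2 / npow be n.+1.
Proof.
move=> be0; rewrite npow_ratio /powR gt_eqF ?divr_gt0//.
apply: le_trans (expR_ge1Dx _); rewrite lerD2l ler_pM2l//.
rewrite -ler_expR lnK ?posrE ?divr_gt0//.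
have := expR_ge1Dx (- (n.+2%:R^-1 : R)); rewrite expRN.
have -> : 1 + - n.+2%:R^-1 = (n.+2%:R / n.+1%:R)^-1 :> R.
  rewrite -[n.+2%:R]natr1; have : (0 : R) < n.+1%:R by [].
  by move: n.+1%:R => m m0; field; rewrite !gt_eqF//; lra.
by rewrite lef_pV2 ?posrE ?expR_gt0 ?divr_gt0.
Qed.

(** The discrete counterpart of the derivative of N^be; summing it bounds the
    sums of N^(be - 1) without distinguishing be < 1 from be > 1. *)
Lemma npow_increment be n : 0 < be ->
  be * (npow be n.+1 / n.+2%:R) <= npow be n.+2 - npow be n.+1.
Proof.
move=> be0; have := npow_ratio_ge n be0.
rewrite ler_pdivlMr ?npow_gt0// => H.
have -> : be * (npow be n.+1 / n.+2%:R) =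
  be / n.+2%:R * npow be n.+1 by rewrite mulrAC mulrA.
by move: H; rewrite mulrDl mul1r addrC -lerBrDr.
Qed.

(** The terms of the series of N^(-1 - be) are dominated by a telescoping
    series. *)
Lemma npow_tail_term be n : 0 < be ->
  (n.+2%:R * npow be n.+2)^-1 <= be^-1 * ((npow be n.+1)^-1 - (npow be n.+2)^-1).
Proof.
move=> be0; have p1 := npow_gt0 be n; have p2 := npow_gt0 be n.+1.
have p3 : (0 : R) < n.+2%:R by [].
have := npow_ratio_ge n be0; set r := _ / npow _ _ => H.
have -> : be^-1 * ((npow be n.+1)^-1 - (npow be n.+2)^-1) =
  be^-1 * ((r - 1) / npow be n.+2).
  by rewrite /r; field; rewrite !gt_eqF.
have -> : (n.+2%:R * npow be n.+2)^-1 = be^-1 * (be / n.+2%:R / npow be n.+2).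
  by field; rewrite !gt_eqF.
by rewrite ler_pM2l ?invr_gt0// ler_pM2r ?invr_gt0// lerBrDl.
Qed.

End Powers.

(** * The critical Riccati inequality *)

Section Riccati.
Variable R : realType.
Implicit Types (al be t s : R) (n : nat).

Lemma npow_ratio_second_order be : exists K, exists2 N : nat, 0 < K &
  forall n, (N <= n)%N ->
    `|npow be n.+2 / npow be n.+1 - 1 - be * n.+1%:R^-1| <= K * n.+1%:R^-1 ^+ 2 /\
    (0 < be -> `|npow be n / npow be n.+1 - 1 + be * n.+1%:R^-1| <=
      K * n.+1%:R^-1 ^+ 2).
Proof.
have [K [e [K0 e0 H]]] := @powR1D_second_order R be.
exists K, (Num.bound e^-1) => // n Nn.
have tpos : (0 : R) < n.+1%:R^-1 by rewrite invr_gt0.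
have te : n.+1%:R^-1 <= e :> R.
  rewrite -[e]invrK lef_pV2 ?posrE ?invr_gt0//.
  apply: le_trans (_ : (Num.bound e^-1)%:R <= _); last by rewrite ler_nat ltnW.
  by apply/ltW/archi_boundP; rewrite invr_ge0 ltW.
split.
  have := H n.+1%:R^-1; rewrite gtr0_norm// => /(_ te).
  rewrite npow_ratio; have -> // : n.+2%:R / n.+1%:R = 1 + n.+1%:R^-1 :> R.
  have : (0 : R) < n.+1%:R by [].
  by rewrite -[n.+2%:R]natr1; move: n.+1%:R => m m0; field; rewrite gt_eqF.
move=> be0; have := H (- n.+1%:R^-1); rewrite normrN gtr0_norm// => /(_ te).
have -> : 1 - n.+1%:R^-1 = n%:R / n.+1%:R :> R.
  have : (0 : R) < n.+1%:R by []; rewrite -[n.+1%:R]natr1.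
  by move: n%:R => m m0; field; rewrite gt_eqF.
rewrite /npow powRM ?ler0n ?invr_ge0// -(powR_inv1 (ler0n _ _)) -powRrM mulN1r powRN.
by rewrite mulrN opprK sqrrN powR_inv1.
Qed.

(** The inequality that makes 2 / al the threshold. With t = s^2 = 1/N it
    compares the Riccati coefficient 2 - s at N with 2 - s' at N + 1; P stands
    for w_(N+1) / w_N and d for 1 - w_(N-1) / w_N, with w_N = N^(2 al), both known
    up to O(t^2). For the constant
    coefficient 2 both sides agree to leading order (equal to 4), so the
    correction has to win at the next order: it contributes s / (2 al) on the
    right, against errors of size t = s^2. The power N^(-1/2) is chosen among
    the N^(-p) with 0 < p < 1 to keep the algebra polynomial. *)
Lemma riccati_critical al (K : R) : 0 < al -> 0 < K -> exists2 s0, 0 < s0 &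
  forall s s' P d, 0 < s -> s <= s0 -> 0 < s' ->
    s' ^+ 2 * (1 + s ^+ 2) = s ^+ 2 ->
    `|P - 1 - 2 * al * s ^+ 2| <= K * (s ^+ 2) ^+ 2 ->
    `|d - 2 * al * s ^+ 2| <= K * (s ^+ 2) ^+ 2 ->
  let G := 2 / (al * s ^+ 2) in
  0 < G - d - (2 - s) /\
  (d + (2 - s)) * ((2 - s') * P) <= G * ((2 - s') * P - (2 - s) - d).
Proof.
move=> al0 K0; set L := 2 * al + K + 1.
have L1 : 1 <= L by rewrite /L; lra.
set D := 2 + L + 12 * K + 32 * L * al.
have La : 0 < L * al by rewrite mulr_gt0//; lra.
have D0 : 0 < D by rewrite /D; lra.
exists D^-1; first by rewrite invr_gt0.
move=> s s' P d s_gt0 sD s'_gt0 ss' HP Hd G.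
have sD1 : s * D <= 1 by rewrite -ler_pdivlMr// div1r.
pose t := s ^+ 2.
have ts : t = s * s by rewrite /t expr2.
rewrite -/t in ss' HP Hd G *.
have t0 : 0 < t by rewrite ts mulr_gt0.
have sDE : s * D = 2 * s + s * L + 12 * (s * K) + 32 * (s * (L * al)).
  by rewrite /D; ring.
have sK0 : 0 < s * K by rewrite mulr_gt0.
have sL0 : 0 < s * L by rewrite mulr_gt0//; lra.
have sLa0 : 0 < s * (L * al) by rewrite mulr_gt0.
have sL : s * L <= 1 by lra.
have sK : s * (12 * K + 32 * L * al) <= 1.
  have -> : s * (12 * K + 32 * L * al) = 12 * (s * K) + 32 * (s * (L * al)) by ring.
  by lra.
have s12 : s <= 2^-1 by lra.
have t_le_s : t <= s by rewrite ts ger_pMr//; move: s12; clear; lra.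
have t1 : t <= 1 by move: t_le_s s12; clear; lra.
have s's : s' <= s.
  rewrite -(@ler_pXn2r _ 2)// ?nnegrE ?(ltW s_gt0) ?(ltW s'_gt0)// -/t -ss'.
  by rewrite ler_peMr ?sqr_ge0//; move: t0; clear; lra.
(* s - s' = t^2 / ((1 + t) (s + s')) *)
have dif : (s - s') * (s + s') * (1 + t) = t ^+ 2.
  rewrite (_ : (s - s') * (s + s') = t - s' ^+ 2); last by rewrite ts; ring.
  by rewrite mulrBl ss'; ring.
have ds0 : 0 <= s - s' by rewrite subr_ge0.
have low : t * s / 4 <= s - s'.
  have h1 : (s - s') * (s + s') * (1 + t) <= (s - s') * (4 * s).
    by rewrite -mulrA ler_wpM2l//; move: s's s_gt0 s'_gt0 t0 t1; clear; nra.
  have h2 : t ^+ 2 = (t * s / 4) * (4 * s) by rewrite ts; field.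
  by move: h1; rewrite dif h2 ler_pM2r// mulr_gt0.
have upp : s - s' <= t * s.
  have h1 : (s - s') * s <= (s - s') * (s + s') * (1 + t).
    by rewrite -mulrA ler_wpM2l//; move: s_gt0 s'_gt0 t0; clear; nra.
  have h2 : t ^+ 2 = (t * s) * s by rewrite ts; ring.
  by move: h1; rewrite dif h2 ler_pM2r.
have t2t : t ^+ 2 <= t by rewrite expr2 ger_pMr.
have t2 : 0 <= t ^+ 2 by exact: sqr_ge0.
move: HP; rewrite ler_norml => /andP[P1 P2].
move: Hd; rewrite ler_norml => /andP[d1 d2].
have Kt2 : K * t ^+ 2 <= K * t by rewrite ler_pM2l.
have Kt0 : 0 <= K * t ^+ 2 by rewrite mulr_ge0// ltW.
have alt : 0 < al * t by rewrite mulr_gt0.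
have Lt0 : 0 < L * t by rewrite mulr_gt0//; move: L1; clear; lra.
have LtE : L * t = 2 * (al * t) + K * t + t by rewrite /L; ring.
have Kts : K * t <= 12^-1.
  have : K * t <= s * K by rewrite [leRHS]mulrC ler_pM2l.
  by move: sK0 sL0 sLa0 sD1 s_gt0; rewrite sDE; clear; lra.
have Lts : L * t <= 1.
  by apply: le_trans sL; rewrite [leRHS]mulrC ler_pM2l//; move: L1; clear; lra.
have altb : 32 * (al * t) <= 1.
  have : al * t <= (L * al) * s by apply: ler_pM;
    rewrite ?(ltW al0) ?(ltW t0)// ler_peMl// ltW.
  rewrite (mulrC (L * al)).
  by move: sK0 sL0 sLa0 sD1 s_gt0; rewrite sDE; clear; lra.
have GE : G * (al * t) = 2 by rewrite /G divfK// gt_eqF.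
have dle : d <= L * t by move: d2 Kt2 LtE t0; clear; lra.
have b_ge : 0 <= d + (2 - s) by move: d1 Kt2 Kts alt s12; clear; lra.
have Ple : P <= 1 + L * t by move: P2 Kt2 LtE t0; clear; lra.
have P0 : 0 <= P by move: P1 Kt2 Kts alt; clear; lra.
split.
  rewrite -(pmulr_lgt0 _ alt) !mulrBl GE.
  have : (d + (2 - s)) * (al * t) <= 3 * (al * t).
    by rewrite ler_pM2r//; move: dle Lts s_gt0; clear; lra.
  by rewrite !mulrDl mulNr; move: altb; clear; lra.
have b'0 : 0 <= 2 - s' by move: s's s12; clear; lra.
have up1 : (d + (2 - s)) * ((2 - s') * P) <= 4 - 4 * s + 16 * (L * t).
  have tLt : t <= L * t by rewrite ler_peMl// ltW.
  have h1 : d + (2 - s) <= 2 - s + L * t by move: dle; clear; lra.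
  have h2 : 2 - s' <= 2 - s + L * t.
    have : t * s <= t by rewrite ger_pMr//; move: s12; clear; lra.
    by move: upp tLt; clear; lra.
  have h3 : (d + (2 - s)) * (2 - s') <= (2 - s + L * t) ^+ 2.
    by rewrite expr2 ler_pM.
  have h4 : (2 - s + L * t) ^+ 2 <= 4 - 4 * s + 6 * (L * t).
    have -> : (2 - s + L * t) ^+ 2 =
        4 - 4 * s + t + 4 * (L * t) - 2 * (s * (L * t)) + (L * t) * (L * t).
      by rewrite ts; ring.
    have : (L * t) * (L * t) <= L * t by rewrite ger_pMl.
    have : 0 <= s * (L * t) by rewrite mulr_ge0// ltW.
    by move: tLt; clear; lra.
  rewrite mulrA; apply: le_trans (_ : (4 - 4 * s + 6 * (L * t)) * (1 + L * t) <= _).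
    by apply: ler_pM => //; [rewrite mulr_ge0|exact: le_trans h4].
  by move: Lt0 Lts s_gt0; clear; nra.
apply: le_trans up1 _.
have low1 : 2 * (al * t) + t * s / 4 - 2 * (al * t) * s - 3 * (K * t ^+ 2) <=
    (2 - s') * P - (2 - s) - d.
  have ts0 : 0 < t * s / 4 by rewrite divr_gt0// mulr_gt0.
  have h1 : (2 - s + t * s / 4) * P <= (2 - s') * P.
    by rewrite ler_wpM2r//; move: low; clear; lra.
  have h2 : (2 - s + t * s / 4) * (1 + 2 * (al * t) - K * t ^+ 2) <=
      (2 - s + t * s / 4) * P.
    by rewrite ler_wpM2l//; [move: s12 ts0|move: P1]; clear; lra.
  have h3 : (t * s / 4) * (K * t ^+ 2) <= s * (K * t ^+ 2).
    by rewrite ler_wpM2r//; move: t1 s_gt0 t0; clear; nra.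
  have h4 : 0 <= (t * s / 4) * (2 * (al * t)) by rewrite !mulr_ge0 ?ltW.
  have h5 : (2 - s + t * s / 4) * (1 + 2 * (al * t) - K * t ^+ 2) =
   (2 - s) + 4 * (al * t) - 2 * (al * t) * s + t * s / 4 - 2 * (K * t ^+ 2)
   + s * (K * t ^+ 2) + (t * s / 4) * (2 * (al * t)) - (t * s / 4) * (K * t ^+ 2) by
     ring.
  by move: h1 h2 h3 h4 d2; rewrite h5; clear; lra.
rewrite -(ler_pM2r alt) mulrAC GE.
have h6 : (4 - 4 * s + 16 * (L * t)) * (al * t) <=
   2 * (2 * (al * t) + t * s / 4 - 2 * (al * t) * s - 3 * (K * t ^+ 2)).
  have h7 : t * (t * (12 * K + 32 * L * al)) <= t * s.
    by rewrite ler_pM2l// ts -mulrA ger_pMr.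
  rewrite -(subr_ge0 (_ * _)).
  have -> : 2 * (2 * (al * t) + t * s / 4 - 2 * (al * t) * s - 3 * (K * t ^+ 2)) -
    (4 - 4 * s + 16 * (L * t)) * (al * t) =
    (t * s - t * (t * (12 * K + 32 * L * al))) / 2 by field.
  by rewrite divr_ge0// subr_ge0.
by apply: le_trans h6 _; rewrite ler_pM2l.
Qed.

Lemma quad_form_ge0 (a b c u w : R) : 0 < a -> b ^+ 2 <= a * c ->
  0 <= a * u ^+ 2 - 2 * b * u * w + c * w ^+ 2.
Proof.
move=> a0 bac; rewrite -(pmulr_rge0 _ a0).
have -> : a * (a * u ^+ 2 - 2 * b * u * w + c * w ^+ 2) =
  (a * u - b * w) ^+ 2 + (a * c - b ^+ 2) * w ^+ 2 by ring.
by rewrite addr_ge0 ?sqr_ge0// mulr_ge0 ?sqr_ge0 ?subr_ge0.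
Qed.

End Riccati.

(** * The Hardy factorisation of the matrix *)

Section Operator.
Variables (R : realType) (al : R).
Hypothesis al0 : 0 < al.
Implicit Types (x y h g : nat -> R) (n k N : nat).


(** The numbers v_N = N^(-1/2-al), N = n + 1, in a form where the square root and
    the power N^al are separate atoms for [field]. *)
Definition vweight n : R := (Num.sqrt n.+1%:R * npow al n.+1)^-1.
(** The increments of N^(2 al); at n = 0 this relies on 0^al = 0. *)
Definition wstep n : R := npow al n.+1 ^+ 2 - npow al n ^+ 2.
(** The tail sum of v_M x_M over M > k, written as an inner product so that
    linearity, Cauchy-Schwarz and weak continuity come for free. *)
Definition tail_sum k x : R := ip x (tailseq k vweight).
(** The factor A of K = A^t A. *)
Definition hardy_op x k : R := Num.sqrt (wstep k) * tail_sum k x.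
(** The form <K x, y>. *)
Definition qform x y : R := ip (hardy_op x) (hardy_op y).

Lemma vweight_gt0 n : 0 < vweight n.
Proof. by rewrite invr_gt0 mulr_gt0 ?npow_gt0// sqrtr_gt0. Qed.

Lemma vweight_sq n : vweight n ^+ 2 = (n.+1%:R * npow al n.+1 ^+ 2)^-1.
Proof. by rewrite /vweight exprVn exprMn sqr_sqrtr. Qed.

Lemma wstep_gt0 n : 0 < wstep n.
Proof.
by rewrite subr_gt0 ltr_pXn2r ?nnegrE ?npow_ge0// npow_lt.
Qed.

Lemma sum_wstep N : \sum_(k < N) wstep k = npow al N ^+ 2.
Proof.
elim: N => [|N IH]; first by rewrite big_ord0 npow0// expr0n.
by rewrite big_ord_recr /= IH /wstep addrC subrK.
Qed.

Definition tail_const : R := 1 + (2 * al)^-1.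

Lemma tail_const_gt0 : 0 < tail_const.
Proof. by rewrite addr_gt0// invr_gt0 mulr_gt0. Qed.

(** The subtracted term makes the bound inductive. *)
Lemma sum_tailseq_vweight N m : \sum_(k < (N + m).+1) tailseq N vweight k ^+ 2 <=
  tail_const / npow al N.+1 ^+ 2 - (2 * al)^-1 / npow al (N + m).+1 ^+ 2.
Proof.
elim: m => [|m IH].
  rewrite addn0 big_ord_recr /= /tailseq leqnn big1 ?add0r => [|k _]; last first.
    by rewrite leqNgt ltn_ord expr0n.
  rewrite vweight_sq /tail_const mulrDl mul1r addrK invfM ger_pMl ?invr_gt0
    ?exprn_gt0 ?npow_gt0//.
  by rewrite invf_le1// ler1n.
rewrite addnS big_ord_recr /= /tailseq (leq_trans (leq_addr m.+1 N)) ?addnS//.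
rewrite vweight_sq -!npow_double.
have := @npow_tail_term R (2 * al) (N + m); rewrite mulr_gt0// => /(_ isT) E.
move: IH; rewrite /tailseq -!npow_double => IH.
by apply: le_trans (lerD IH E) _; rewrite mulrBr addrA subrK.
Qed.

Lemma sum_tailseq_vweight_le N n : \sum_(k < n) tailseq N vweight k ^+ 2 <=
  tail_const / npow al N.+1 ^+ 2.
Proof.
apply: le_trans (_ : \sum_(k < (N + n).+1) tailseq N vweight k ^+ 2 <= _).
  rewrite -addSn addnC big_split_ord /= lerDl.
  by apply: sumr_ge0 => k _; exact: sqr_ge0.
apply: le_trans (sum_tailseq_vweight N n) _; rewrite gerBl.
by rewrite divr_ge0 ?invr_ge0 ?mulr_ge0 ?exprn_ge0 ?npow_ge0 ?(ltW al0).
Qed.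

Lemma sqsum_tailseq_vweight N : sqsum (tailseq N vweight).
Proof. by eexists => n; exact: sum_tailseq_vweight_le. Qed.

Lemma tailseq0 x : tailseq 0 x = x. Proof. by apply/funext. Qed.

Lemma sqsum_vweight : sqsum vweight.
Proof. by rewrite -(tailseq0 vweight); exact: sqsum_tailseq_vweight. Qed.

Lemma ip_tailseq_vweight N : ip (tailseq N vweight) (tailseq N vweight) <=
  tail_const / npow al N.+1 ^+ 2.
Proof. by apply: ip_le => [|n];
  [exact: sqsum_tailseq_vweight|exact: sum_tailseq_vweight_le]. Qed.

(** The tail sums are O(N^(-al)) with a constant that tends to zero with the
    tail of x; this kills every boundary term of a summation by parts. *)
Lemma tail_sum_decay N x : sqsum x ->
  npow al N.+1 ^+ 2 * tail_sum N x ^+ 2 <= tail_const * ip (tailseq N x) (tailseq N x).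
Proof.
move=> sx; rewrite /tail_sum -tailseq_idem -ip_tailseqr.
have := ip_CS (sqsum_tailseq N sx) (sqsum_tailseq_vweight N).
have := ip_tailseq_vweight N; have := ip_ge0 (sqsum_tailseq N sx).
have p2 : 0 < npow al N.+1 ^+ 2 by rewrite exprn_gt0// npow_gt0.
rewrite ler_pdivlMr// mulrC.
move: (ip _ _) (ip (tailseq N vweight) _) (ip (tailseq N x) (tailseq N vweight)) => u
  v w u0 uv uw.
apply: le_trans (_ : npow al N.+1 ^+ 2 * (u * v) <= _); first by rewrite ler_pM2l.
by rewrite mulrCA [leRHS]mulrC ler_wpM2l.
Qed.

Lemma tail_sumD x y k : sqsum x -> sqsum y ->
  tail_sum k (x + y) = tail_sum k x + tail_sum k y.
Proof. by move=> sx sy; rewrite /tail_sum ipDl//; exact: sqsum_tailseq_vweight. Qed.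

Lemma tail_sumZ c x k : sqsum x -> tail_sum k (c *: x) = c * tail_sum k x.
Proof. by move=> sx; rewrite /tail_sum ipZl//; exact: sqsum_tailseq_vweight. Qed.

Lemma tail_sum_lincomb j (c : 'I_j -> R) (f : 'I_j -> nat -> R) k :
  (forall i, sqsum (f i)) ->
    tail_sum k (\sum_(i < j) c i *: f i) = \sum_(i < j) c i * tail_sum k (f i).
Proof. by move=> sf; rewrite /tail_sum ip_suml//; exact: sqsum_tailseq_vweight. Qed.

Lemma tail_sumE k x : sqsum x ->
  tail_sum k x = ip x vweight - \sum_(i < k) x i * vweight i.
Proof. by move=> sx; rewrite /tail_sum -ip_tailseqr ip_tailseq//;
  exact: sqsum_vweight. Qed.

Lemma tail_sum_step k x : sqsum x -> tail_sum k x - tail_sum k.+1 x = vweight k * x k.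
Proof. by move=> sx; rewrite !tail_sumE// big_ord_recr /=; ring. Qed.

(** The Riccati sequence b_N = N^(2 al) (2 - N^(-1/2)). *)
Definition riccati_coef k : R := npow al k.+1 ^+ 2 * (2 - Num.sqrt (k.+1%:R^-1)).

Lemma riccati_coef_le k : riccati_coef k <= 2 * npow al k.+1 ^+ 2.
Proof.
by rewrite /riccati_coef mulrC ler_wpM2r ?exprn_ge0 ?npow_ge0// gerBl sqrtr_ge0.
Qed.

(** Since S_k - S_(k+1) = v_k x_k, this is the positivity of a quadratic form
    in (S_k, S_(k+1)), whose discriminant is controlled by [riccati_critical].
    The b-terms telescope when the inequality is summed. *)
Lemma riccati_step : exists M, forall k, (M <= k)%N -> forall x, sqsum x ->
  wstep k * tail_sum k x ^+ 2 + riccati_coef k * tail_sum k x ^+ 2 - riccati_coef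
    k.+1 * tail_sum k.+1 x ^+ 2
    <= 2 / al * x k ^+ 2.
Proof.
have [K [N K0 H]] := @npow_ratio_second_order R (2 * al).
have [s0 s0_gt0 H'] := riccati_critical al0 K0.
exists (maxn N (Num.bound (s0 ^- 2))) => k; rewrite geq_max => /andP[Nk Bk] x sx.
have kpos : (0 : R) < k.+1%:R by [].
have kne : (k.+1%:R : R) != 0 by rewrite pnatr_eq0.
have al20 : 0 < 2 * al by rewrite mulr_gt0.
have pk := npow_gt0 al k.
pose s : R := Num.sqrt (k.+1%:R^-1); pose s' : R := Num.sqrt (k.+2%:R^-1).
have sE : s ^+ 2 = k.+1%:R^-1 by rewrite sqr_sqrtr// invr_ge0.
have s'E : s' ^+ 2 = k.+2%:R^-1 by rewrite sqr_sqrtr// invr_ge0.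
have s_gt0 : 0 < s by rewrite sqrtr_gt0 invr_gt0.
have s'_gt0 : 0 < s' by rewrite sqrtr_gt0 invr_gt0.
have ss0 : s <= s0.
  rewrite -(@ler_pXn2r _ 2)// ?nnegrE ?(ltW s_gt0) ?(ltW s0_gt0)// sE.
  rewrite -[leRHS]invrK lef_pV2 ?posrE ?invr_gt0 ?exprn_gt0//.
  apply: le_trans (_ : (Num.bound (s0 ^- 2))%:R <= _); last by rewrite ler_nat ltnW.
  by apply/ltW/archi_boundP; rewrite invr_ge0 exprn_ge0// ltW.
have [] := H k Nk; rewrite !npow_double -sE => HP /(_ al20) Hd.
have := H' s s' (npow al k.+2 ^+ 2 / npow al k.+1 ^+ 2) (1 - npow al k ^+ 2 / npow al
  k.+1 ^+ 2)
  s_gt0 ss0 s'_gt0.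
case=> //.
- rewrite s'E sE -[k.+2%:R]natr1; move: kpos; clear; move: k.+1%:R => m m0.
  by field; rewrite !gt_eqF//; lra.
- by rewrite -normrN (_ : - (_ - _) =
  npow al k ^+ 2 / npow al k.+1 ^+ 2 - 1 + 2 * al * s ^+ 2)//; ring.
set P := npow al k.+2 ^+ 2 / _; set d := 1 - _; set G := 2 / _.
move=> h1 h2.
have := @quad_form_ge0 _ (G - d - (2 - s)) G (G + (2 - s') * P) (tail_sum k x)
  (tail_sum k.+1 x) h1.
have -> : G ^+ 2 <= (G - d - (2 - s)) * (G + (2 - s') * P).
  rewrite -subr_ge0.
  have -> : (G - d - (2 - s)) * (G + (2 - s') * P) - G ^+ 2 =
    G * ((2 - s') * P - (2 - s) - d) - (d + (2 - s)) * ((2 - s') * P) by ring.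
  by rewrite subr_ge0.
move=> /(_ isT) h3.
have h4 : 0 <= npow al k.+1 ^+ 2 * (G * (tail_sum k x - tail_sum k.+1 x) ^+ 2 - d *
  tail_sum k x ^+ 2
   - (2 - s) * tail_sum k x ^+ 2 + (2 - s') * P * tail_sum k.+1 x ^+ 2).
  rewrite mulr_ge0 ?exprn_ge0 ?npow_ge0//; apply: le_trans h3 _.
  by rewrite le_eqVlt; apply/orP; left; apply/eqP; ring.
move: h4; rewrite tail_sum_step// /wstep /riccati_coef -/s -/s'.
have -> : npow al k.+1 ^+ 2 * (G * (vweight k * x k) ^+ 2 - d * tail_sum k x ^+ 2
   - (2 - s) * tail_sum k x ^+ 2 + (2 - s') * P * tail_sum k.+1 x ^+ 2) =
   2 / al * x k ^+ 2 - ((npow al k.+1 ^+ 2 - npow al k ^+ 2) * tail_sum k x ^+ 2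
   + npow al k.+1 ^+ 2 * (2 - s) * tail_sum k x ^+ 2 - npow al k.+2 ^+ 2 * (2 - s') *
     tail_sum k.+1 x ^+ 2).
  rewrite /G /d /P exprMn vweight_sq sE.
  move: pk kpos; move: (npow al k.+1) k.+1%:R => p m p0 m0.
  by field; rewrite !gt_eqF.
by rewrite subr_ge0.
Qed.

(** The telescoped sum of [riccati_step]. The boundary term on the right is
    kept because summability of the left-hand side is a consequence, not an
    assumption. *)
Lemma hardy_partial : exists M, forall x, sqsum x -> forall N,
  \sum_(k < N) wstep k * tail_sum k x ^+ 2 <= 2 / al * ip x x +
   \sum_(k < M) wstep k * tail_sum k x ^+ 2 + 2 * tail_const * ip (tailseq N x)
     (tailseq N x).
Proof.
have [M HM] := riccati_step; exists M => x sx N.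
have d0 k : 0 <=
  wstep k * tail_sum k x ^+ 2 by rewrite mulr_ge0 ?sqr_ge0 ?ltW ?wstep_gt0.
have t0 := ip_ge0 (sqsum_tailseq N sx).
have t1 : 0 <= 2 * tail_const * ip (tailseq N x) (tailseq N x).
  by rewrite !mulr_ge0// ltW// tail_const_gt0.
have i0 := ip_ge0 sx; have al20 : 0 <= 2 / al by rewrite divr_ge0// ltW.
have [NM|MN] := leqP N M.
  rewrite -(subnKC NM) big_split_ord /=.
  have : 0 <= \sum_(i < M - N) wstep (N + i) * tail_sum (N + i) x ^+ 2 by exact:
    sumr_ge0.
  have : 0 <= 2 / al * ip x x by rewrite mulr_ge0.
  by move: t1; clear; lra.
have tele m : \sum_(k < M + m) wstep k * tail_sum k x ^+ 2 <=
    2 / al * \sum_(k < M + m) x k ^+ 2 + \sum_(k < M) wstep k * tail_sum k x ^+ 2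
    + riccati_coef (M + m) * tail_sum (M + m) x ^+ 2.
  elim: m => [|m IH].
    rewrite addn0 -addrA addrCA lerDl addr_ge0//.
      by rewrite mulr_ge0// sumr_ge0// => k _; exact: sqr_ge0.
    rewrite mulr_ge0 ?sqr_ge0// mulr_ge0 ?exprn_ge0 ?npow_ge0// subr_ge0.
    have h : Num.sqrt M.+1%:R^-1 <= 1 :> R.
      by rewrite -[leRHS]sqrtr1 ler_wsqrtr// invf_le1// ler1n.
    by apply: le_trans h _; rewrite ler1n.
  rewrite addnS !big_ord_recr /= mulrDr.
  by have := HM (M + m)%N (leq_addr _ _) x sx; move: IH; clear; lra.
have := tele (N - M)%N; rewrite subnKC ?(ltnW MN)// => H.
apply: le_trans H _; rewrite addrAC [leRHS]addrAC.
have h1 : riccati_coef N * tail_sum N x ^+ 2 <=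
  2 * tail_const * ip (tailseq N x) (tailseq N x).
  apply: le_trans (_ : 2 * (npow al N.+1 ^+ 2 * tail_sum N x ^+ 2) <= _).
    by rewrite mulrA ler_wpM2r ?sqr_ge0 ?riccati_coef_le.
  by rewrite -mulrA ler_pM2l// tail_sum_decay.
have h2 : 2 / al * (\sum_(k < N) x k ^+ 2) <= 2 / al * ip x x.
  by rewrite ler_wpM2l// le_ip.
by move: h1 h2; clear; lra.
Qed.

Lemma hardy_op_sq x k : hardy_op x k ^+ 2 = wstep k * tail_sum k x ^+ 2.
Proof. by rewrite exprMn sqr_sqrtr// ltW// wstep_gt0. Qed.

Lemma ip_tailseq_le N x : sqsum x -> ip (tailseq N x) (tailseq N x) <= ip x x.
Proof.
by move=> sx; rewrite ip_tailseq2// gerBl sumr_ge0// => k _; exact: sqr_ge0.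
Qed.

Lemma sqsum_hardy_op x : sqsum x -> sqsum (hardy_op x).
Proof.
have [M HM] := hardy_partial; move=> sx; eexists => N.
under eq_bigr do rewrite hardy_op_sq.
apply: le_trans (HM x sx N) _; apply: lerD (lexx _) _.
apply: ler_wpM2l (ip_tailseq_le N sx); rewrite mulr_ge0// ltW//; exact: tail_const_gt0.
Qed.

(** A Hardy inequality with the sharp constant 2 / al up to a finite-rank
    form. *)
Lemma hardy : exists M, forall x, sqsum x ->
  qform x x <= 2 / al * ip x x + \sum_(k < M) wstep k * tail_sum k x ^+ 2.
Proof.
have [M HM] := hardy_partial; exists M => x sx.
have sA := sqsum_hardy_op sx.
have H : (fun N => 2 / al * ip x x + \sum_(k < M) wstep k * tail_sum k x ^+ 2 +
    2 * tail_const * ip (tailseq N x) (tailseq N x)) @ \oo -->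
    2 / al * ip x x + \sum_(k < M) wstep k * tail_sum k x ^+ 2 + 2 * tail_const * 0.
  by apply: cvgD; [exact: cvg_cst|apply: cvgMl_tmp; exact: ip_tailseq_cvg0].
rewrite mulr0 addr0 in H.
apply: ler_cvg_to (ip_cvg sA sA) H _; near=> N => /=.
apply: le_trans (HM x sx N); rewrite le_eqVlt; apply/orP; left; apply/eqP.
by apply: eq_bigr => k _; rewrite -expr2 hardy_op_sq.
Unshelve. all: by end_near. Qed.

Lemma hardy_opD x y : sqsum x -> sqsum y -> hardy_op (x + y) = hardy_op x + hardy_op y.
Proof. by move=> sx sy; apply/funext => k; rewrite /hardy_op tail_sumD// mulrDr. Qed.

Lemma hardy_opZ c x : sqsum x -> hardy_op (c *: x) = c *: hardy_op x.
Proof. by move=> sx; apply/funext => k; rewrite /hardy_op tail_sumZ// mulrCA. Qed.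

Lemma qformC x y : qform x y = qform y x. Proof. exact: ipC. Qed.

Lemma qform_ge0 x : sqsum x -> 0 <= qform x x.
Proof. by move=> sx; apply/ip_ge0/sqsum_hardy_op. Qed.

Lemma qform_expand x y t : sqsum x -> sqsum y ->
  qform (x + t *: y) (x + t *: y) = qform x x + 2 * t * qform x y + t ^+ 2 * qform y y.
Proof.
move=> sx sy; rewrite /qform hardy_opD//; last exact: sqsumZ.
by rewrite hardy_opZ// ip_expand//; exact: sqsum_hardy_op.
Qed.

Lemma qform_suml j (c : 'I_j -> R) (f : 'I_j -> nat -> R) h :
  (forall i, sqsum (f i)) -> sqsum h ->
  qform (\sum_(i < j) c i *: f i) h = \sum_(i < j) c i * qform (f i) h.
Proof.
move=> sf sh; rewrite /qform.
have -> : hardy_op (\sum_(i < j) c i *: f i) = \sum_(i < j) c i *: hardy_op (f i).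
  apply/funext => k.
  have -> : (\sum_(i < j) c i *: hardy_op (f i)) k =
    \sum_(i < j) c i * hardy_op (f i) k.
    by rewrite fct_sumE.
  by rewrite /hardy_op tail_sum_lincomb// mulr_sumr; apply: eq_bigr => i _;
    rewrite mulrCA.
by rewrite ip_suml// => [i|]; exact: sqsum_hardy_op.
Qed.

(** Summation by parts: the adjoint of the Hardy operator maps g to
    v_n sum_(k <= n) (w_k - w_(k-1)) g_k. The boundary term is
    (sum_(k < N) (w_k - w_(k-1)) g_k) S_N(h), where the first factor is O(N^al)
    by Cauchy-Schwarz and the second is o(N^(-al)) by [tail_sum_decay]. *)
Lemma adjoint_cvg g h : sqsum (fun k => Num.sqrt (wstep k) * g k) -> sqsum h ->
  (fun N => \sum_(n < N) (vweight n * \sum_(k < n.+1) wstep k * g k) * h n) @ \oo -->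
  ip (fun k => Num.sqrt (wstep k) * g k) (hardy_op h).
Proof.
move=> sg sh; set w := fun k => _ in sg *.
have dwE k : wstep k * g k = Num.sqrt (wstep k) * w k.
  by rewrite /w mulrA -expr2 sqr_sqrtr// ltW// wstep_gt0.
have partial N : \sum_(n < N) (vweight n * \sum_(k < n.+1) wstep k * g k) * h n =
    \sum_(k < N) w k * hardy_op h k - (\sum_(k < N) wstep k * g k) * tail_sum N h.
  elim: N => [|N IH]; first by rewrite !big_ord0 mul0r subr0.
  rewrite big_ord_recr /= IH !(big_ord_recr N) /=.
  have -> : w N * hardy_op h N =
    wstep N * g N * tail_sum N h by rewrite dwE /hardy_op; ring.
  have -> : tail_sum N.+1 h =
    tail_sum N h - vweight N * h N by rewrite -tail_sum_step// opprB addrC subrK.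
  by ring.
under eq_fun do rewrite partial.
rewrite -[ip w _]subr0; apply: cvgB; first exact: (ip_cvg sg (sqsum_hardy_op sh)).
have bound N : ((\sum_(k < N) wstep k * g k) * tail_sum N h) ^+ 2 <=
   (ip w w * tail_const) * ip (tailseq N h) (tailseq N h).
  have h1 : (\sum_(k < N) wstep k * g k) ^+ 2 <= npow al N.+1 ^+ 2 * ip w w.
    under eq_bigr do rewrite dwE.
    apply: le_trans (sum_CS (fun k => Num.sqrt (wstep k)) w N) _.
    have sq0 (u : nat -> R) : 0 <= \sum_(k < N) u k ^+ 2.
      by apply: sumr_ge0 => k _; exact: sqr_ge0.
    apply: (ler_pM (sq0 (fun k => Num.sqrt (wstep k))) (sq0 w)); last exact: le_ip.
    under eq_bigr do rewrite sqr_sqrtr ?(ltW (wstep_gt0 _))//.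
    by rewrite sum_wstep ler_pXn2r ?nnegrE ?npow_ge0// npow_le.
  rewrite exprMn;
    apply: le_trans (_ : (npow al N.+1 ^+ 2 * ip w w) * tail_sum N h ^+ 2 <= _).
    by rewrite ler_wpM2r ?sqr_ge0.
  rewrite mulrAC mulrC -[leRHS]mulrA ler_wpM2l ?ip_ge0//; exact: tail_sum_decay.
have b0 : (fun N => (ip w w * tail_const) * ip (tailseq N h) (tailseq N h)) @ \oo -->
  (0 : R).
  rewrite -(mulr0 (ip w w * tail_const)); apply: cvgMl_tmp; exact: ip_tailseq_cvg0.
apply/cvgrPdist_lt => e e0.
move/cvgrPdist_lt: b0 => /(_ (e ^+ 2)); rewrite exprn_gt0// => /(_ isT).
case=> N0 _ HN0; exists N0 => // N /= /HN0 /=; rewrite !sub0r !normrN => H.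
rewrite -(@ltr_pXn2r _ 2)// ?nnegrE ?(ltW e0)// real_normK ?num_real//.
by apply: le_lt_trans (bound N) _; apply: le_lt_trans (ler_norm _) H.
Qed.

End Operator.

(** * Linear dependence *)

Section LinearDependence.
Variable R : realType.

(** The left kernel of a matrix with more rows than columns is not zero. *)
Lemma linear_dependence j M (A : 'I_j -> 'I_M -> R) : (M < j)%N ->
  exists2 c : 'I_j -> R, exists i, c i != 0 & forall m, \sum_i c i * A i m = 0.
Proof.
move=> Mj; pose B : 'M[R]_(j, M) := \matrix_(i, m) A i m.
have : ~~ row_free B.
  by rewrite /row_free neq_ltn (leq_ltn_trans (rank_leq_col B)).
rewrite -kermx_eq0 => /rowV0Pn[u /sub_kermxP uB u0].
exists (u 0); last first.
  move=> m; transitivity ((u *m B) 0 m); last by rewrite uB mxE.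
  by rewrite mxE; apply: eq_bigr => i _; rewrite mxE.
move/rV0Pn: u0 => [i ui]; by exists i.
Qed.

End LinearDependence.

(** * Eigenvectors, finiteness above the threshold, and the variational principle *)

Section Eigenpairs.
Variables (R : realType) (al : R).
Hypothesis al0 : 0 < al.
Implicit Types (x y h g : nat -> R) (n k N : nat) (l : R).

Local Notation vweight := (vweight al).
Local Notation wstep := (wstep al).
Local Notation tail_sum := (tail_sum al).
Local Notation hardy_op := (hardy_op al).
Local Notation qform := (qform al).

(** The equation K x = l x after factorisation; it only involves [tail_sum],
    which makes the recurrence visible. *)
Definition eigen_eq l x := forall n, l * x n =
  vweight n * \sum_(k < n.+1) wstep k * tail_sum k x.

Definition eigenpair l x := [/\ sqsum x, x <> 0 & eigen_eq l x].

(** The right-hand side of the eigenvalue equation is the adjoint of the Hardy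
    operator applied to the transform of x. *)
Lemma qform_weak l x h : sqsum x -> eigen_eq l x -> sqsum h -> qform x h = l * ip x h.
Proof.
move=> sx ex sh.
have H := adjoint_cvg al0 (sqsum_hardy_op al0 sx) sh.
have H' : (fun N => \sum_(n < N) l * x n * h n) @ \oo --> qform x h.
  by under eq_fun do under eq_bigr do rewrite ex.
have H2 : (fun N => \sum_(n < N) l * x n * h n) @ \oo --> l * ip x h.
  under eq_fun do under eq_bigr do rewrite -mulrA.
  under eq_fun do rewrite -mulr_sumr.
  by apply: cvgMl_tmp; exact: ip_cvg.
exact: (cvg_unique _ H' H2).
Qed.

Lemma qform_unit x n : sqsum x ->
  qform x (unit_seq R n) = vweight n * \sum_(k < n.+1) wstep k * tail_sum k x.
Proof.
move=> sx; have H := adjoint_cvg al0 (sqsum_hardy_op al0 sx) (sqsum_unit R n).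
set a := fun n => vweight n * \sum_(k < n.+1) wstep k * tail_sum k x.
have H0 : (fun=> a n) @ \oo --> a n by exact: cvg_cst.
have H1 : (fun N => \sum_(m < N) a m * unit_seq R n m) @ \oo --> a n.
  apply: cvg_trans H0; apply: near_eq_cvg; exists n.+1 => // N /= nN.
  by rewrite (sum_unit n N a) nN.
exact: (cvg_unique _ H H1).
Qed.

Lemma eigenpair_of_weak l x : sqsum x -> x <> 0 ->
  (forall n, qform x (unit_seq R n) = l * ip x (unit_seq R n)) -> eigenpair l x.
Proof. by move=> sx x0 H; split=> // n; rewrite -qform_unit// H ip_unit. Qed.

Lemma eigenpair_orthogonal l l' x y : eigenpair l x -> eigenpair l' y -> l != l' ->
  ip x y = 0.
Proof.
move=> [sx _ ex] [sy _ ey] ll'.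
have := qform_weak sx ex sy; rewrite qformC (qform_weak sy ey sx) ipC => /eqP.
by rewrite -subr_eq0 -mulrBl mulf_eq0 subr_eq0 eq_sym (negbTE ll') => /eqP.
Qed.

Lemma eigenpair_norm_gt0 l x : eigenpair l x -> 0 < ip x x.
Proof.
move=> [sx x0 _]; rewrite lt0r ip_ge0// andbT; apply/eqP => ip0.
by apply: x0; apply: ip_eq0 => //; rewrite ip0.
Qed.

(** If the eigenvalue is not positive then the form vanishes at x, so all
    tail sums do, and their differences recover x. *)
Lemma eigenpair_gt0 l x : eigenpair l x -> 0 < l.
Proof.
move=> ex; have [sx x0 rx] := ex; have xx := eigenpair_norm_gt0 ex.
have := qform_ge0 al0 sx; rewrite (qform_weak sx rx sx) pmulr_lge0// le0r.
case/predU1P => // l0; exfalso; apply: x0.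
have /ip_eq0 A0 : sqsum (hardy_op x) by exact: sqsum_hardy_op.
have {}A0 : hardy_op x = 0.
  by apply: A0; rewrite -/(qform x x) (qform_weak sx rx sx) l0 mul0r.
have S0 k : tail_sum k x = 0.
  have /eqP := congr1 (fun f => f k) A0;
    rewrite /= mulf_eq0 sqrtr_eq0 leNgt wstep_gt0//.
  by move=> /= /eqP.
apply/funext => n; have /eqP := tail_sum_step al0 n sx.
by rewrite !S0 subr0 eq_sym mulf_eq0 gt_eqF ?vweight_gt0// => /eqP.
Qed.

(** The eigenvalue equation as a recurrence: x_n gives S_(n+1) from S_n, and
    S_0, ..., S_n give x_n. *)
Lemma eigen_eq_head0 l x : sqsum x -> l != 0 -> eigen_eq l x -> x 0%N = 0 -> x = 0.
Proof.
move=> sx l0 ex x0.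
have main n : tail_sum n x = 0 /\ x n = 0.
  elim/ltn_ind: n => n IH.
  have Sn : tail_sum n x = 0.
    case: n IH => [_|n IH].
      have := ex 0%N; rewrite x0 mulr0 big_ord_recr big_ord0 /= add0r => /esym/eqP.
      rewrite mulf_eq0 gt_eqF ?vweight_gt0//= mulf_eq0 gt_eqF ?wstep_gt0//=.
      by move=> /eqP.
    have [Sn xn] := IH n (ltnSn n).
    have := tail_sum_step al0 n sx; rewrite Sn xn mulr0 sub0r => /eqP.
    by rewrite oppr_eq0 => /eqP.
  split=> //; apply/eqP; have /eqP := ex n;
    rewrite big1 ?mulr0 ?mulf_eq0 ?(negbTE l0)//.
  move=> k _; have [->|kn] := eqVneq (k : nat) n; first by rewrite Sn mulr0.
  have [|-> _] := IH k; last by rewrite mulr0.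
  by rewrite ltn_neqAle kn -ltnS ltn_ord.
by apply/funext => n; have [] := main n.
Qed.

(** Eigenvalues are simple: the combination of x and y that vanishes at the
    first coordinate is zero, so x and y are proportional. *)
Lemma eigenpair_simple l x y : eigenpair l x -> eigenpair l y -> ip x y <> 0.
Proof.
move=> ex ey xy0; have l0 := eigenpair_gt0 ex.
have xx := eigenpair_norm_gt0 ex.
have [sx x0 rx] := ex; have [sy y0 ry] := ey.
have yh : y 0%N != 0.
  by apply/eqP => /(eigen_eq_head0 sy _ ry) yz; apply: y0; apply: yz; rewrite gt_eqF.
have s1 : sqsum (y 0%N *: x) by exact: sqsumZ.
have s2 : sqsum ((- x 0%N) *: y) by exact: sqsumZ.
have u0 : y 0%N *: x + (- x 0%N) *: y = 0.
  apply: (@eigen_eq_head0 l); [exact: sqsumD|by rewrite gt_eqF| |].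
    move=> n.
    have -> : (y 0%N *: x + (- x 0%N) *: y) n = y 0%N * x n - x 0%N * y n.
      by rewrite -mulNr.
    under eq_bigr do rewrite tail_sumD// !tail_sumZ// mulrDr !(mulrCA (wstep _)).
    rewrite big_split /= -!mulr_sumr [RHS]mulrDr !(mulrCA (vweight _)) -rx -ry.
    by ring.
  by rewrite [LHS](_ : _ = y 0%N * x 0%N + - x 0%N * y 0%N)//; ring.
have := congr1 (fun z => ip z x) u0;
  rewrite /= ipDl// !ipZl// ip0l (ipC y) xy0 mulr0 addr0.
by move=> /eqP; rewrite mulf_eq0 (negbTE yh) (gt_eqF xx).
Qed.

Section Family.
Variables (j : nat) (lam : 'I_j -> R) (f : 'I_j -> nat -> R).
Hypothesis lamI : injective lam.
Hypothesis ef : forall i, eigenpair (lam i) (f i).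

Lemma family_sqsum i : sqsum (f i). Proof. by have [] := ef i. Qed.
Lemma family_eigen_eq i : eigen_eq (lam i) (f i). Proof. by have [] := ef i. Qed.

Lemma family_orth i i' : i != i' -> ip (f i) (f i') = 0.
Proof.
move=> ii'; apply: (eigenpair_orthogonal (ef i) (ef i')).
by apply: contra_neq ii' => /lamI.
Qed.

Lemma ip_family (c : 'I_j -> R) i : ip (\sum_i c i *: f i) (f i) = c i * ip (f i) (f i).
Proof.
rewrite ip_suml//; [|exact: family_sqsum|exact: family_sqsum].
rewrite (bigD1 i)//= big1 ?addr0// => i' ii'.
by rewrite family_orth ?mulr0.
Qed.

Lemma ip_family2 (c : 'I_j -> R) : ip (\sum_i c i *: f i) (\sum_i c i *: f i) =
  \sum_i c i ^+ 2 * ip (f i) (f i).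
Proof.
rewrite ip_suml//; [|exact: family_sqsum|exact: sqsum_sum family_sqsum].
by apply: eq_bigr => i _; rewrite ipC ip_family mulrA -expr2.
Qed.

Lemma qform_family2 (c : 'I_j -> R) : qform (\sum_i c i *: f i) (\sum_i c i *: f i) =
  \sum_i c i ^+ 2 * (lam i * ip (f i) (f i)).
Proof.
have ss := sqsum_sum c family_sqsum.
rewrite qform_suml//; [|exact: family_sqsum].
apply: eq_bigr => i _;
  rewrite (qform_weak (family_sqsum i) (@family_eigen_eq i) ss) ipC ip_family.
by ring.
Qed.

Lemma family_norm_gt0 (c : 'I_j -> R) : (exists i, c i != 0) ->
  0 < ip (\sum_i c i *: f i) (\sum_i c i *: f i).
Proof.
move=> [i ci]; rewrite ip_family2 (bigD1 i)//=.
apply: ltr_wpDr; last first.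
  by rewrite mulr_gt0 ?(eigenpair_norm_gt0 (ef i))// lt0r sqrf_eq0 ci sqr_ge0.
by apply: sumr_ge0 => k _;
  rewrite mulr_ge0 ?sqr_ge0// ltW// (eigenpair_norm_gt0 (ef k)).
Qed.

End Family.

(** With more eigenvectors than the rank M of the exceptional form in [hardy],
    a nontrivial combination is invisible to that form; there the form is both
    at most 2 / al times the squared norm and, by orthogonality, larger. *)
Lemma finitely_many : exists M, forall j (lam : 'I_j -> R) (f : 'I_j -> nat -> R),
  injective lam -> (forall i, eigenpair (lam i) (f i)) ->
  (forall i, 2 / al < lam i) -> (j <= M)%N.
Proof.
have [M HM] := hardy al0; exists M => j lam f lamI ef lamgt.
rewrite leqNgt; apply/negP => Mj.
have [c c0 Hc] := linear_dependence (fun i m => tail_sum m (f i)) Mj.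
have sf := family_sqsum ef; have sx := sqsum_sum c sf.
have := HM _ sx; rewrite [X in _ + X]big1 => [|k _]; last first.
  by rewrite tail_sum_lincomb// (Hc k) expr0n mulr0.
rewrite addr0 leNgt => /negP; apply.
rewrite (qform_family2 lamI ef) (ip_family2 lamI ef) -subr_gt0 mulr_sumr -sumrB.
case: c0 => i ci; rewrite (bigD1 i)//=; apply: ltr_wpDr.
  apply: sumr_ge0 => k _; rewrite mulrCA -mulrBl mulr_ge0 ?subr_ge0 ?(ltW (lamgt k))//.
  by rewrite mulr_ge0 ?sqr_ge0// ltW//; exact: eigenpair_norm_gt0 (ef k).
rewrite mulrCA -mulrBl mulr_gt0 ?subr_gt0// mulr_gt0//;
  last exact: eigenpair_norm_gt0 (ef i).
by rewrite lt0r sqrf_eq0 ci sqr_ge0.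
Qed.

Lemma fmap_ultra (T U : Type) (phi : T -> U) (F : set_system T) :
  UltraFilter F -> UltraFilter (phi @ F).
Proof.
move=> FU; split; first exact: fmap_proper_filter.
move=> G GF FG; rewrite predeqE => A; split; last exact: FG.
move=> GA; have [//|FnA] := in_ultra_setVsetC (phi @^-1` A) FU.
have GnA : G (~` A) by exact: FG.
by have /filter_ex [? []] : G (A `&` (~` A)) by exact: filterI.
Qed.

Lemma bounded_ultra_cvg (T : Type) (F : set_system T) (u : T -> R) (B : R) :
  UltraFilter F -> (forall t, `|u t| <= B) -> exists l, u t @[t --> F] --> l.
Proof.
move=> FU uB; have cB : compact `[- B, B] by exact: segment_compact.
move: cB; rewrite compact_ultra => /(_ (u @ F) (fmap_ultra u FU)).
case; last by move=> l [_ ul]; exists l.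
suff : F (u @^-1` `[- B, B]) by [].
by apply: filterE => t /=; have := uB t; rewrite ler_norml in_itv.
Qed.

Lemma tail_sum_sq_le k x : sqsum x ->
  tail_sum k x ^+ 2 <= ip x x * ip (tailseq k vweight) (tailseq k vweight).
Proof. by move=> sx; apply: ip_CS => //; exact: sqsum_tailseq_vweight. Qed.

Section Maximizer.
Variables (j : nat) (lam : 'I_j -> R) (f : 'I_j -> nat -> R) (c : R).
Hypothesis lamI : injective lam.
Hypothesis ef : forall i, eigenpair (lam i) (f i).
Hypothesis c_ge : 2 / al <= c.

Let perp x := sqsum x /\ forall i, ip x (f i) = 0.

Let perpD x y t : perp x -> perp y -> perp (x + t *: y).
Proof.
move=> [sx px] [sy py]; have sty : sqsum (t *: y) by exact: sqsumZ.
split=> [|i]; first exact: sqsumD.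
by rewrite ipDl ?ipZl ?px ?py ?mulr0 ?addr0//; exact: family_sqsum ef i.
Qed.

Let perpZ x t : perp x -> perp (t *: x).
Proof.
move=> [sx px]; split=> [|i]; first exact: sqsumZ.
by rewrite ipZl ?px ?mulr0//; exact: family_sqsum ef i.
Qed.

Lemma qformZ2 t x : sqsum x -> qform (t *: x) (t *: x) = t ^+ 2 * qform x x.
Proof.
move=> sx; rewrite /qform hardy_opZ// ipZl ?ipZr//; first by rewrite expr2 mulrA.
- exact: sqsum_hardy_op.
- exact: sqsum_hardy_op.
- exact: sqsum_hardy_op.
- by apply: sqsumZ; exact: sqsum_hardy_op.
Qed.

Lemma qform00 : qform 0 0 = 0.
Proof. by have := qformZ2 0 (sqsum0 R); rewrite scale0r expr0n mul0r. Qed.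

Lemma ipZ2 t x : sqsum x -> ip (t *: x) (t *: x) = t ^+ 2 * ip x x.
Proof.
by move=> sx; rewrite ipZl ?ipZr//; [rewrite expr2 mulrA|exact: sqsumZ].
Qed.

(** The direct method. A maximising sequence of the Rayleigh quotient on the
    orthogonal complement of the f_i has a coordinatewise limit x along an
    ultrafilter. With L the supremum, L |z|^2 - <K z, z> is a nonnegative form
    on the complement which tends to zero along the sequence, so Cauchy-Schwarz
    for it gives <K x, h> = L <x, h> for every h of the complement, and the f_i
    are eigenvectors orthogonal to x, which gives the other h. The limit is not
    zero, for otherwise [hardy] would give L <= 2 / al. *)
Lemma exists_maximizer x0 : sqsum x0 -> (forall i, ip x0 (f i) = 0) ->
  c * ip x0 x0 < qform x0 x0 ->
  exists l x, [/\ c < l, eigenpair l x & forall i, ip x (f i) = 0].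
Proof.
move=> sx0 px0 Bx0; have c0 : 0 < c by apply: lt_le_trans c_ge; rewrite divr_gt0.
have [M HM] := hardy al0.
pose E := [set qform x x | x in [set x | perp x /\ ip x x = 1]].
have normalize x : perp x -> 0 < ip x x -> E (qform x x / ip x x).
  move=> px xx; exists ((Num.sqrt (ip x x))^-1 *: x).
    split; first exact: perpZ.
    by rewrite ipZ2 ?exprVn ?sqr_sqrtr ?mulVf ?gt_eqF ?ltW//; case: px.
  by rewrite qformZ2 ?exprVn ?sqr_sqrtr ?(ltW xx)// 1?mulrC//; case: px.
have x00 : 0 < ip x0 x0.
  rewrite lt0r ip_ge0// andbT; apply/eqP => /eqP; rewrite eq_le => /andP[x00 _].
  move: Bx0; by rewrite (ip_eq0 sx0 x00) ip0l mulr0 qform00 ltxx.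
have Ex0 : E (qform x0 x0 / ip x0 x0) by exact: normalize.
pose B := 2 / al + \sum_(k < M) wstep k * ip (tailseq k vweight) (tailseq k vweight).
have Eub : ubound E B.
  move=> _ [x [[sx px] x1] <-]; apply: le_trans (HM x sx) _.
  rewrite x1 mulr1 lerD2l; apply: ler_sum => k _.
  by rewrite ler_wpM2l ?(ltW (wstep_gt0 al0 _))//; have := tail_sum_sq_le k sx;
    rewrite x1 mul1r.
have hE : has_sup E by split; [exists (qform x0 x0 / ip x0 x0)|exists B].
set L := sup E.
have cL : c < L.
  apply: lt_le_trans (_ : qform x0 x0 / ip x0 x0 <= _); first by rewrite ltr_pdivlMr.
  by apply: ub_le_sup => //; exists B.
have L0 : 0 < L by exact: lt_trans cL.
have BL x : perp x -> qform x x <= L * ip x x.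
  move=> px; have [sx _] := px; have := ip_ge0 sx; rewrite le0r => /predU1P[xx|xx].
    have xE : x = 0 by apply: ip_eq0 => //; rewrite xx.
    by rewrite xx mulr0 xE qform00.
  by rewrite -ler_pdivrMr//; apply: ub_le_sup; [exists B|exact: normalize].
have /choice[u Hu] : forall n, exists x, [/\ perp x, ip x x =
  1 & L - n.+1%:R^-1 < qform x x].
  move=> n; have [||_ [x [px x1] <-] H] := @sup_adherent _ E n.+1%:R^-1 => //.
  by exists x.
have su n : sqsum (u n) by have [[]] := Hu n.
have u1 n : ip (u n) (u n) <= 1 by have [_ ->] := Hu n.
(* an ultrafilter replaces the extraction of a diagonal subsequence *)
have [G [GU FG]] := @ultraFilterLemma nat \oo _.
have GP : ProperFilter G by exact: ultra_proper.
have /choice[x ux] : forall n, exists l, u t n @[t --> G] --> l.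
  move=> n; apply: (bounded_ultra_cvg (B := 1)) => t.
  rewrite -(@ler_pXn2r _ 2)// ?nnegrE// expr1n real_normK ?num_real//.
  by apply: le_trans (u1 t); apply: le_trans (le_ip n.+1 (su t));
    rewrite big_ord_recr /= lerDr sumr_ge0// => k _; exact: sqr_ge0.
have sx : sqsum x by exact: weak_limit_sqsum su u1 ux.
have wk h : sqsum h -> ip (u t) h @[t --> G] --> ip x h.
  by move=> sh; exact: weak_limit_ip su u1 ux _ sh.
have wS k : tail_sum k (u t) @[t --> G] --> tail_sum k x by apply: wk;
  exact: sqsum_tailseq_vweight.
have wB h : sqsum h -> qform (u t) h @[t --> G] --> qform x h.
  move=> sh; apply: (@weak_limit_ip _ _ _ _ (fun t => hardy_op (u t)) L (hardy_op x))
    => //.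
  - by move=> t; exact: sqsum_hardy_op.
  - by move=> t; have [pu u1' _] := Hu t; have := BL _ pu; rewrite u1' mulr1.
  - by move=> k; apply: cvgMl_tmp; exact: wS.
  - exact: sqsum_hardy_op.
have px i : ip x (f i) = 0.
  have sfi := family_sqsum ef i.
  have H0 : ip (u t) (f i) @[t --> G] --> (0 : R).
    rewrite (_ : (fun t => _) = fun=> 0); first exact: cvg_cst.
    by apply/funext => t; have [[_ ->]] := Hu t.
  exact: (cvg_unique (@norm_hausdorff _ _) (wk _ sfi) H0).
have inv0 : (fun n => n.+1%:R^-1 : R) @ G --> (0 : R).
  exact: cvg_trans (cvg_app _ FG) (@cvg_harmonic R).
have eqV h : perp h -> qform x h = L * ip x h.
  move=> ph; have [sh _] := ph.
  have dlim : (L * ip (u t) h - qform (u t) h) ^+ 2 @[t --> G] -->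
     (L * ip x h - qform x h) ^+ 2.
    have d1 : L * ip (u t) h - qform (u t) h @[t --> G] --> L * ip x h - qform x h.
      by apply: cvgB; [apply: cvgMl_tmp; exact: wk|exact: wB].
    by under eq_fun do rewrite expr2; rewrite expr2; exact: cvgM.
  pose g z := L * ip z z - qform z z.
  have g0 z : perp z -> 0 <= g z by move=> /BL; rewrite subr_ge0.
  have rlim : t.+1%:R^-1 * g h @[t --> G] --> 0 * g h by exact: cvgMr_tmp.
  have : (L * ip x h - qform x h) ^+ 2 <= 0 * g h.
    apply: ler_cvg_to dlim rlim _; apply: filterE => t.
    have [pu u1' uL] := Hu t.
    apply: le_trans (_ : g (u t) * g h <= _).
      apply: quad_disc => [|r]; first exact: g0.
      have := g0 _ (perpD r pu ph).
      by rewrite /g ip_expand// qform_expand// => H; apply: le_trans H _;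
        rewrite le_eqVlt; apply/orP; left; apply/eqP; ring.
    rewrite ler_wpM2r ?g0// /g u1' mulr1 lerBlDr -lerBlDl; exact: ltW.
  rewrite mul0r => d0.
  have /eqP : (L * ip x h - qform x h) ^+ 2 = 0 by apply/eqP; rewrite eq_le d0 sqr_ge0.
  by rewrite sqrf_eq0 subr_eq0 => /eqP.
exists L, x; split=> //; apply: eigenpair_of_weak => //.
  move=> x0'; move: cL; rewrite ltNge => /negP; apply; apply: le_trans c_ge.
  have l1 : L - t.+1%:R^-1 @[t --> G] --> L - 0.
    by apply: cvgB => //; exact: cvg_cst.
  have l2 : 2 / al + \sum_(k < M) wstep k * tail_sum k (u t) ^+ 2 @[t --> G] -->
      2 / al + \sum_(k < M) wstep k * tail_sum k x ^+ 2.
    apply: cvgD; [exact: cvg_cst|apply: cvg_ord_sum => k; apply: cvgMl_tmp].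
    by under eq_fun do rewrite expr2; rewrite expr2; exact: cvgM.
  have : L - 0 <= 2 / al + \sum_(k < M) wstep k * tail_sum k x ^+ 2.
    apply: ler_cvg_to l1 l2 _; apply: filterE => t.
    have [[sut _] u1' uL] := Hu t.
    by apply: le_trans (ltW uL) _; have := HM _ sut; rewrite u1' mulr1.
  rewrite subr0 big1 ?addr0// => k _.
  by rewrite x0' /tail_sum ip0l expr0n mulr0.
move=> n; set h := unit_seq R n; have sh : sqsum h by exact: sqsum_unit.
(* orthogonal projection of the coordinate vector h to the complement *)
pose b i := - (ip h (f i) / ip (f i) (f i)).
pose p := \sum_i b i *: f i.
have sp : sqsum p by exact: sqsum_sum (family_sqsum ef).
have ph' : perp (h + 1 *: p).
  split=> [|i]; first by rewrite scale1r; exact: sqsumD.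
  rewrite scale1r ipDl//; last exact: family_sqsum ef i.
  rewrite (ip_family lamI ef) /b mulNr divfK ?subrr// gt_eqF//.
  exact: eigenpair_norm_gt0 (ef i).
have xp : ip x p = 0.
  by rewrite ipC ip_suml ?big1// => [i _|i];
    [rewrite ipC px mulr0|exact: family_sqsum ef i].
have Bp : qform x p = 0.
  rewrite qformC qform_suml// => [|i]; last exact: family_sqsum ef i.
  rewrite big1// => i _; have [sfi _ ri] := ef i.
  by rewrite (qform_weak sfi ri sx) ipC px !mulr0.
have := eqV _ ph'; rewrite scale1r ipDr// xp addr0 => <-.
rewrite /qform hardy_opD// ipDr; [|exact: sqsum_hardy_op..].
by rewrite -[ip _ (hardy_op p)]/(qform x p) Bp addr0.
Qed.

End Maximizer.

End Eigenpairs.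

(** * Decaying solutions of perturbed linear flows *)

Ltac nonneg := solve [repeat first
  [ assumption | (apply: ltW; assumption) | exact: sqr_ge0 | exact: ler0n | exact: ler01
  | apply: addr_ge0 | apply: mulr_ge0 | (rewrite invr_ge0) ]].

Section Asymptotics.
Variable R : realType.
Implicit Types (al l K B : R) (Y T a m : nat -> R).

(** Sums of 1 / (n (n + 1)) telescope to 1 / n; the bound is transported from
    infinity, where the sequence vanishes. *)
Lemma telescoping_tail a D N : (0 < N)%N -> a @ \oo --> (0 : R) ->
  (forall n, (N <= n)%N -> `|a n.+1 - a n| <= D / (n%:R * n.+1%:R)) ->
  forall n, (N <= n)%N -> `|a n| <= D / n%:R.
Proof.
move=> N0 a0 Ha n Nn.
have n0 : (0 : R) < n%:R by rewrite ltr0n (leq_trans N0).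
have step k : `|a n| <= `|a (n + k)%N| + D * (n%:R^-1 - (n + k)%:R^-1).
  elim: k => [|k IH]; first by rewrite addn0 subrr mulr0 addr0.
  apply: le_trans IH _.
  have nk0 : (0 : R) < (n + k)%:R by rewrite ltr0n addn_gt0 -(ltr0n R) n0.
  have -> : a (n + k)%N = a (n + k).+1 - (a (n + k).+1 - a (n + k)%N) by ring.
  rewrite addnS; apply: le_trans (lerD (ler_normB _ _) (lexx _)) _.
  have := Ha (n + k)%N (leq_trans Nn (leq_addr _ _)).
  have -> : D / ((n + k)%:R * (n + k).+1%:R) =
    D * (n%:R^-1 - (n + k).+1%:R^-1) - D * (n%:R^-1 - (n + k)%:R^-1).
    rewrite -[(n + k).+1%:R]natr1; move: n0 nk0; move: n%:R (n + k)%:R => p q p0 q0.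
    by field; rewrite !gt_eqF//; lra.
  by move: (D * _) (D * _) => r s; lra.
have D0 : 0 <= D.
  have := le_trans (normr_ge0 _) (Ha n Nn).
  by rewrite pmulr_lge0// invr_gt0 mulr_gt0.
have lim0 : `|a (n + k)%N| + D / n%:R @[k --> \oo] --> `|0 : R| + D / n%:R.
  apply: cvgD; last exact: cvg_cst.
  have sh : (fun k => a (n + k)%N) @ \oo --> (0 : R).
    have := a0; rewrite -(cvg_shiftn n) => H.
    by under eq_fun do rewrite addnC.
  exact: cvg_norm sh.
rewrite normr0 add0r in lim0.
apply: ler_cvg_to (cvg_cst _) lim0 _; apply: filterE => k.
apply: le_trans (step k) _; rewrite lerD2l ler_wpM2l// gerBl.
by rewrite invr_ge0 ler0n.
Qed.

(** A contraction on the set of upper bounds of the sequence. *)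
Lemma halving_zero m B N : (forall n, 0 <= m n) ->
  (forall n, (N <= n)%N -> m n <= B) ->
  (forall C, 0 <= C -> (forall n, (N <= n)%N -> m n <= C) ->
     forall n, (N <= n)%N -> m n <= C / 2) ->
  forall n, (N <= n)%N -> m n = 0.
Proof.
move=> m0 mB half n Nn.
have B0 : 0 <= B by exact: le_trans (m0 n) (mB n Nn).
have mk k : forall n, (N <= n)%N -> m n <= B * 2^-1 ^+ k.
  elim: k => [|k IH] p Np; first by rewrite expr0 mulr1 mB.
  rewrite exprSr mulrA; apply: half => //.
  by rewrite mulr_ge0// exprn_ge0.
apply/eqP; rewrite eq_le m0 andbT.
have lim0 : B * 2^-1 ^+ k @[k --> \oo] --> B * 0.
  apply: cvgMl_tmp; apply: cvg_expr; rewrite ger0_norm ?invr_ge0//.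
  by rewrite invf_lt1// ltr1n.
rewrite mulr0 in lim0.
apply: ler_cvg_to (cvg_cst _) lim0 _; apply: filterE => k; exact: mk.
Qed.

(** An Euler scheme, with time step 1 / (n + 1), of the linear system
    Y' = 2 al T - al Y, T' = al T - Y / l, up to errors O(1 / n^2). The system is
    Hamiltonian; its eigenvalues have square al^2 - 2 al / l, so they are
    imaginary for l < 2 / al and zero for l = 2 / al. *)
Definition perturbed_flow al l K N Y T := forall n, (N <= n)%N ->
  `|Y n.+1 - Y n - n.+1%:R^-1 * (2 * al * T n - al * Y n)| <=
     K * n.+1%:R^-1 ^+ 2 * (`|Y n| + `|T n|) /\
  `|T n.+1 - T n - n.+1%:R^-1 * (al * T n - Y n / l)| <=
     K * n.+1%:R^-1 ^+ 2 * (`|Y n| + `|T n|).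

Lemma inv_sq_le n (c : R) : (0 < n)%N -> 0 <= c ->
  c * n.+1%:R^-1 ^+ 2 <= c / (n%:R * n.+1%:R).
Proof.
move=> n0 c0; rewrite ler_wpM2l// exprVn lef_pV2 ?posrE ?mulr_gt0 ?exprn_gt0 ?ltr0n//.
by rewrite expr2 ler_wpM2r// ler_nat.
Qed.

(** The Hamiltonian of that system, hence an invariant of it. *)
Definition ham al l (y u : R) : R := al * u ^+ 2 - al * y * u + y ^+ 2 / (2 * l).

(** The first-order variation of the Hamiltonian along its own flow vanishes
    identically, so that one step changes it by second-order terms only. *)
Lemma ham_step al l K : 0 < al -> 0 < l -> 0 <= K -> exists2 Q, 0 <= Q &
  forall t y u y' u' : R, 0 < t -> t <= 1 ->
  `|y' - y - t * (2 * al * u - al * y)| <= K * t ^+ 2 * (`|y| + `|u|) ->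
  `|u' - u - t * (al * u - y / l)| <= K * t ^+ 2 * (`|y| + `|u|) ->
  `|ham al l y' u' - ham al l y u| <= Q * t ^+ 2 * (`|y| + `|u|) ^+ 2.
Proof.
move=> al0 l0 K0; set v := l^-1; have v0 : 0 < v by rewrite invr_gt0.
pose A := 2 * al + K; pose D := al + v + K.
have A0 : 0 <= A by rewrite /A addr_ge0// mulr_ge0// ltW.
have D0 : 0 <= D by rewrite /D !addr_ge0// ltW.
exists ((v + 3 * al) * K + (al * D ^+ 2 + al * A * D + v * A ^+ 2)).
  by rewrite !(addr_ge0, mulr_ge0, exprn_ge0)// ltW.
move=> t y u y' u' t0 t1; rewrite -/v.
set M := `|y| + `|u|; set a := t * (2 * al * u - al * y).
set b := t * (al * u - y * v).
have My : `|y| <= M by rewrite lerDl.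
have Mu : `|u| <= M by rewrite lerDr.
have M0 : 0 <= M by rewrite addr_ge0.
set e := y' - y - a; set f := u' - u - b => He Hf.
have y'E : y' = y + (a + e) by rewrite /e; ring.
have u'E : u' = u + (b + f) by rewrite /f; ring.
set p := a + e in y'E; set q := b + f in u'E.
have Et : K * t ^+ 2 * M <= t * M * K.
  rewrite [leRHS]mulrC -mulrA ler_wpM2l// ler_wpM2r// expr2.
  by rewrite ger_pMl.
have tM0 : 0 <= t * M by rewrite mulr_ge0// ltW.
have alu : `|al * u| <= al * M by rewrite normrM gtr0_norm// ler_pM2l.
have aly : `|al * y| <= al * M by rewrite normrM gtr0_norm// ler_pM2l.
have vy : `|y * v| <= v * M by rewrite normrM (gtr0_norm v0) mulrC ler_pM2l.
have c1 : `|y * v - al * u| <= (v + al) * M.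
  by apply: le_trans (ler_normB _ _) _; rewrite mulrDl lerD.
have c2 : `|2 * al * u - al * y| <= 2 * al * `|u| + al * `|y|.
  apply: le_trans (ler_normB _ _) _; rewrite !normrM (gtr0_norm al0).
  by rewrite ger0_norm.
have c2' : `|2 * al * u - al * y| <= 2 * al * M.
  apply: le_trans c2 _; rewrite /M mulrDr addrC lerD2r -mulrA.
  by rewrite ler_peMl ?ler1n// mulr_ge0// ltW.
have pA : `|p| <= t * M * A.
  apply: le_trans (ler_normD _ _) _; rewrite /A mulrDr lerD//;
    last exact: le_trans He Et.
  by rewrite /a normrM (gtr0_norm t0) -[leRHS]mulrA ler_pM2l// [leRHS]mulrC.
have qD : `|q| <= t * M * D.
  apply: le_trans (ler_normD _ _) _; rewrite /D mulrDr lerD//;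
    last exact: le_trans Hf Et.
  rewrite /b normrM (gtr0_norm t0) -[leRHS]mulrA ler_pM2l//.
  by apply: le_trans (ler_normB _ _) _; rewrite mulrDr (mulrC M) (mulrC M) lerD.
have -> : ham al l y' u' - ham al l y u =
    ((y * v - al * u) * e + (2 * al * u - al * y) * f) + ham al l p q.
  rewrite y'E u'E /ham /p /q.
  have : (y * v - al * u) * a + (2 * al * u - al * y) * b = 0 by rewrite /a /b; ring.
  rewrite invfM -/v => ab0.
  transitivity (((y * v - al * u) * a + (2 * al * u - al * y) * b) +
   ((y * v - al * u) * e + (2 * al * u - al * y) * f +
    (al * (b + f) ^+ 2 - al * (a + e) * (b + f) + (a + e) ^+ 2 * (2^-1 * v)))).
    by field.
  by rewrite ab0 add0r.
have h1 : `|(y * v - al * u) * e + (2 * al * u - al * y) * f| <=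
    (v + 3 * al) * K * (t ^+ 2 * M ^+ 2).
  apply: le_trans (ler_normD _ _) _; rewrite !normrM.
  apply: le_trans (_ : (v + al) * M * (K * t ^+ 2 * M) + 2 * al * M * (K * t ^+ 2 *
    M) <= _).
    by rewrite lerD// ler_pM.
  by rewrite le_eqVlt; apply/orP; left; apply/eqP; ring.
have h2 : `|ham al l p q| <=
  (al * D ^+ 2 + al * A * D + v * A ^+ 2) * (t ^+ 2 * M ^+ 2).
  rewrite /ham invfM -/v.
  have pp : p ^+ 2 <= (t * M * A) ^+ 2.
    by rewrite -(real_normK (num_real p)) ler_pXn2r ?nnegrE// mulr_ge0.
  have qq : q ^+ 2 <= (t * M * D) ^+ 2.
    by rewrite -(real_normK (num_real q)) ler_pXn2r ?nnegrE// mulr_ge0.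
  have pq : `|p * q| <= (t * M * A) * (t * M * D) by rewrite normrM ler_pM.
  have n1 : `|al * q ^+ 2| <= al * (t * M * D) ^+ 2.
    by rewrite normrM gtr0_norm// ger0_norm ?sqr_ge0// ler_pM2l.
  have n2 : `|al * p * q| <= al * ((t * M * A) * (t * M * D)).
    by rewrite -mulrA normrM gtr0_norm// ler_pM2l.
  have n3 : `|p ^+ 2 * (2^-1 * v)| <= (t * M * A) ^+ 2 * v.
    rewrite normrM ger0_norm ?sqr_ge0// ger0_norm;
      last by rewrite mulr_ge0 ?invr_ge0// ltW.
    apply: ler_pM; rewrite ?sqr_ge0//; first by rewrite mulr_ge0 ?invr_ge0// ltW.
    by rewrite ger_pMl// invf_le1// ler1n.
  apply: le_trans (ler_normD _ _) _; apply: le_trans (lerD (ler_normB _ _) (lexx _)) _.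
  apply: le_trans (lerD (lerD n1 n2) n3) _.
  by rewrite le_eqVlt; apply/orP; left; apply/eqP; ring.
apply: le_trans (ler_normD _ _) _; apply: le_trans (lerD h1 h2) _.
by rewrite le_eqVlt; apply/orP; left; apply/eqP; ring.
Qed.

Lemma nat_above (x : R) : exists2 N : nat, (0 < N)%N & forall n, (N <= n)%N ->
  x <= n%:R.
Proof.
exists (Num.bound `|x|).+1 => // n Nn.
apply: le_trans (_ : (Num.bound `|x|)%:R <= _); last by rewrite ler_nat ltnW.
by apply: le_trans (ler_norm _) _; apply/ltW/archi_boundP.
Qed.

Lemma cvg0_bounded (a : nat -> R) : a @ \oo --> (0 : R) ->
  exists N : nat, forall n, (N <= n)%N -> `|a n| <= 1.
Proof.
move=> /cvgrPdist_lt/(_ 1 ltr01)[N _ HN]; exists N => n Nn.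
by have /ltW := HN n Nn; rewrite sub0r normrN.
Qed.

Lemma sum_norm_cvg0 Y T : Y @ \oo --> (0 : R) -> T @ \oo --> (0 : R) ->
  (fun n => `|Y n| + `|T n|) @ \oo --> (0 : R).
Proof.
move=> Y0 T0.
have : (fun n => `|Y n| + `|T n|) @ \oo --> `|0 : R| + `|0 : R|.
  by apply: cvgD; exact: cvg_norm.
by rewrite normr0 addr0.
Qed.

(** For l < 2 / al the Hamiltonian is positive definite. If |Y|^2 + |T|^2 <= C
    from some index on, then the Hamiltonian, which tends to zero, is O(C / n),
    and so C may be halved. *)
Lemma elliptic_flow_zero al l K N Y T : 0 < al -> 0 < l -> l < 2 / al -> 0 <= K ->
  Y @ \oo --> (0 : R) -> T @ \oo --> (0 : R) -> perturbed_flow al l K N Y T ->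
  exists N', forall n, (N' <= n)%N -> `|Y n| + `|T n| = 0.
Proof.
move=> al0 l0 lal K0 Y0 T0 flow.
(* the Hamiltonian is al (T - Y/2)^2 + ep Y^2 *)
pose ep := (2 * l)^-1 - al / 4.
have ep0 : 0 < ep.
  rewrite subr_gt0 invfM (_ : al / 4 = 2^-1 * (al / 2)); last by field.
  by rewrite ltr_pM2l ?invr_gt0// -[ltLHS]invrK invf_div ltf_pV2 ?posrE ?divr_gt0.
(* (|Y| + |T|)^2 <= 2 p^2 + (9/2) Y^2 with p = T - Y/2 *)
pose D := 2 / al + 9 / (2 * ep).
have D0 : 0 < D by rewrite addr_gt0// divr_gt0// mulr_gt0.
pose m n := (`|Y n| + `|T n|) ^+ 2.
have mH n : m n <= D * ham al l (Y n) (T n).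
  have -> : ham al l (Y n) (T n) = al * (T n - Y n / 2) ^+ 2 + ep * Y n ^+ 2.
    by rewrite /ham /ep; field; rewrite gt_eqF.
  rewrite /m; set y := Y n; set u := T n; set p := u - y / 2.
  have h1 : `|y| + `|u| <= `|p| + 3 / 2 * `|y|.
    have -> : u = p + y / 2 by rewrite /p subrK.
    have := ler_normD p (y / 2); rewrite normrM (@ger0_norm _ 2^-1) ?invr_ge0//.
    by lra.
  have h2 : (`|y| + `|u|) ^+ 2 <= 2 * p ^+ 2 + 9 / 2 * y ^+ 2.
    apply: le_trans (_ : (`|p| + 3 / 2 * `|y|) ^+ 2 <= _).
      by rewrite ler_pXn2r ?nnegrE ?addr_ge0// mulr_ge0// divr_ge0.
    rewrite -(real_normK (num_real p)) -(real_normK (num_real y)).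
    by have := sqr_ge0 (`|p| - 3 / 2 * `|y|); move: `|p| `|y| => r s; clear; lra.
  apply: le_trans h2 _.
  have -> : D * (al * p ^+ 2 + ep * y ^+ 2) = (2 * p ^+ 2 + 9 / 2 * y ^+ 2) +
     (9 / (2 * ep) * al * p ^+ 2 + 2 / al * ep * y ^+ 2).
    by rewrite /D; field; rewrite !gt_eqF.
  rewrite lerDl addr_ge0//.
    apply: mulr_ge0 (sqr_ge0 _); apply: mulr_ge0 (ltW al0).
    by rewrite divr_ge0// mulr_ge0// ltW.
  by apply: mulr_ge0 (sqr_ge0 _); apply: mulr_ge0 (ltW ep0); rewrite divr_ge0// ltW.
have [Q Q0 HQ] := ham_step al0 l0 K0.
have H0 : (fun n => ham al l (Y n) (T n)) @ \oo --> (0 : R).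
  rewrite (_ : 0 = al * (0 * 0) - al * 0 * 0 + 0 * 0 / (2 * l) :> R);
    last by rewrite !mulr0 mul0r subrr addr0.
  rewrite /ham; under eq_fun do rewrite !expr2.
  by apply: cvgD; [apply: cvgB; apply: cvgM => //;
    [exact: cvg_cst|exact: cvgM|apply: cvgMl_tmp]|apply: cvgMr_tmp; exact: cvgM].
have [N1 HN1] := cvg0_bounded (sum_norm_cvg0 Y0 T0).
have [N2 N20 HN2] := nat_above (2 * D * Q).
pose N' := maxn N (maxn N1 N2); exists N'.
have N'0 : (0 < N')%N by rewrite !leq_max N20 !orbT.
have mz := @halving_zero m 1 N'; move=> n Nn; apply/eqP; rewrite -sqrf_eq0; apply/eqP.
apply: mz Nn => [k|k Nk|C C0 mC k Nk]; first exact: sqr_ge0.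
- rewrite /m expr_le1 ?addr_ge0// -[leLHS]ger0_norm ?addr_ge0//.
  by apply: HN1; apply: leq_trans Nk; rewrite !leq_max leqnn !orbT.
- have k0 : (0 : R) < k%:R by rewrite ltr0n (leq_trans N'0).
  apply: le_trans (mH k) _.
  apply: le_trans (_ : D * ((Q * C) / k%:R) <= _).
    rewrite ler_pM2l//; apply: le_trans (ler_norm _) _.
    apply: (telescoping_tail N'0 H0) Nk => i Ni.
    have i0 : (0 < i)%N by exact: leq_trans Ni.
    have [f1 f2] := flow i (leq_trans (leq_maxl _ _) Ni).
    have t1 : i.+1%:R^-1 <= 1 :> R by rewrite invf_le1// ler1n.
    apply: le_trans (HQ _ _ _ _ _ _ t1 f1 f2) _; first by rewrite invr_gt0.
    apply: le_trans (inv_sq_le i0 (mulr_ge0 Q0 C0)).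
    rewrite -mulrA -[leRHS]mulrA ler_wpM2l// mulrC ler_wpM2r ?exprn_ge0 ?invr_ge0//.
    exact: mC.
  have := HN2 k (leq_trans _ Nk); rewrite !leq_max leqnn !orbT => /(_ isT) kb.
  rewrite mulrA ler_pdivrMr// mulrAC ler_pdivlMr//.
  have -> : D * (Q * C) * 2 = C * (2 * D * Q) by ring.
  by rewrite ler_wpM2l.
Qed.

(** At l = 2 / al the Hamiltonian degenerates to the square of p = T - Y / 2.
    Then p is almost constant and Y changes by 2 al p / n, so a bound C on both
    gives p = O(C / n) first, and Y = O(C / n) from it. *)
Lemma parabolic_flow_zero al l K N Y T : 0 < al -> l = 2 / al -> 0 <= K ->
  Y @ \oo --> (0 : R) -> T @ \oo --> (0 : R) -> perturbed_flow al l K N Y T ->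
  exists N', forall n, (N' <= n)%N -> `|Y n| + `|T n| = 0.
Proof.
move=> al0 lE K0 Y0 T0 flow.
pose p n := T n - Y n / 2.
have p0 : p @ \oo --> (0 : R).
  rewrite (_ : 0 = 0 - 0 / 2 :> R); last by rewrite mul0r subr0.
  by apply: cvgB => //; apply: cvgMr_tmp.
pose m n := `|Y n| + `|T n|.
have m0 n : 0 <= m n by rewrite addr_ge0.
have [N1 HN1] := cvg0_bounded (sum_norm_cvg0 Y0 T0).
(* p = O(A C / n) and then Y = O(E C / n) *)
pose A := 2 * K; have A0 : 0 <= A by rewrite mulr_ge0.
pose E := 2 * al * A + K.
have E0 : 0 <= E by rewrite addr_ge0// !mulr_ge0// ltW.
have [N2 N20 HN2] := nat_above (2 * (A + 3 / 2 * E)).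
pose N' := maxn N (maxn N1 N2); exists N'.
have N'0 : (0 < N')%N by rewrite !leq_max N20 !orbT.
apply: (@halving_zero m 1 N') => // [k Nk|C C0 mC k Nk].
  rewrite -[leLHS]ger0_norm//.
  by apply: HN1; apply: leq_trans Nk; rewrite !leq_max leqnn !orbT.
have err i : (N' <= i)%N ->
    K * i.+1%:R^-1 ^+ 2 * (`|Y i| + `|T i|) <= K * C / (i%:R * i.+1%:R).
  move=> Ni; have i0 : (0 < i)%N by exact: leq_trans Ni.
  apply: le_trans (inv_sq_le i0 (mulr_ge0 K0 C0)).
  by rewrite -mulrA -[leRHS]mulrA ler_wpM2l// mulrC ler_wpM2r ?exprn_ge0 ?invr_ge0// mC.
have pb i : (N' <= i)%N -> `|p i| <= A * C / i%:R.
  apply: (telescoping_tail N'0 p0) => {}i Ni.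
  have [f1 f2] := flow i (leq_trans (leq_maxl _ _) Ni).
  have e1 := le_trans f1 (err i Ni); have e2 := le_trans f2 (err i Ni).
  have -> : p i.+1 - p i =
      (T i.+1 - T i - i.+1%:R^-1 * (al * T i - Y i / l)) -
      (Y i.+1 - Y i - i.+1%:R^-1 * (2 * al * T i - al * Y i)) / 2.
    by rewrite /p lE invf_div; move: i.+1%:R^-1 => t; field; rewrite ?gt_eqF.
  apply: le_trans (ler_normB _ _) _; rewrite normrM (@ger0_norm _ 2^-1) ?invr_ge0//.
  have -> : A * C / (i%:R * i.+1%:R) = 2 * (K * C / (i%:R * i.+1%:R)).
    by rewrite /A !mulrA.
  move: e1 e2; set r := _ / (_ * _); move: `|_| `|_| => u w.
  have r0 : 0 <= r by rewrite divr_ge0 ?mulr_ge0.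
  by move: r0; clear; lra.
have Yb i : (N' <= i)%N -> `|Y i| <= E * C / i%:R.
  apply: (telescoping_tail N'0 Y0) => {}i Ni.
  have i0 : (0 : R) < i%:R by rewrite ltr0n (leq_trans N'0).
  have [f1 _] := flow i (leq_trans (leq_maxl _ _) Ni).
  have e1 := le_trans f1 (err i Ni).
  have -> : Y i.+1 - Y i =
      (Y i.+1 - Y i - i.+1%:R^-1 * (2 * al * T i - al * Y i)) +
      i.+1%:R^-1 * (2 * al) * p i.
    by rewrite /p; move: i.+1%:R^-1 => t; field.
  apply: le_trans (ler_normD _ _) _.
  rewrite (_ : E * C / _ =
    K * C / (i%:R * i.+1%:R) + i.+1%:R^-1 * (2 * al) * (A * C / i%:R)); last first.
    rewrite /E invfM; ring.
  apply: lerD e1 _; rewrite normrM ger0_norm; last by rewrite !mulr_ge0 ?invr_ge0// ltW.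
  by rewrite ler_wpM2l ?pb// !mulr_ge0 ?invr_ge0// ltW.
have k0 : (0 : R) < k%:R by rewrite ltr0n (leq_trans N'0).
have h1 : m k <= `|p k| + 3 / 2 * `|Y k|.
  rewrite /m /p; have := ler_normD (T k - Y k / 2) (Y k / 2).
  by rewrite subrK normrM (@ger0_norm _ 2^-1) ?invr_ge0//; clear; lra.
apply: le_trans h1 _.
apply: le_trans (_ : A * C / k%:R + 3 / 2 * (E * C / k%:R) <= _).
  by apply: lerD; [exact: pb|rewrite ler_wpM2l ?divr_ge0// Yb].
have := HN2 k (leq_trans _ Nk); rewrite !leq_max leqnn !orbT => /(_ isT) kb.
have -> : A * C / k%:R + 3 / 2 * (E * C / k%:R) = (C * (A + 3 / 2 * E)) / k%:R by ring.
rewrite ler_pdivrMr// (_ : C / 2 * k%:R = C * (k%:R / 2)); last by rewrite mulrA mulrAC.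
rewrite ler_wpM2l//; by move: kb; clear; lra.
Qed.

End Asymptotics.

(** * No eigenvalue at or below the threshold *)

Section Threshold.
Variables (R : realType) (al : R).
Hypothesis al0 : 0 < al.
Implicit Types (x y h g : nat -> R) (n k N : nat) (l : R).

Local Notation vweight := (vweight al).
Local Notation wstep := (wstep al).
Local Notation tail_sum := (tail_sum al).
Local Notation hardy_op := (hardy_op al).

(** For an eigenvector this is l N^(1/2+al) x_N. *)
Definition slope_sum x n : R := \sum_(k < n) wstep k * tail_sum k x.
(** With S the tail sums and P = [slope_sum], the scalings Y = P / N^al and
    T = N^al S turn the recurrence for (S, P) into a perturbation of a flow with
    constant coefficients. *)
Definition Yseq x n : R := slope_sum x n.+1 / npow al n.+1.
Definition Tseq x n : R := npow al n.+1 * tail_sum n.+1 x.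

Lemma npow_unbounded (B : R) : exists N : nat, forall n, (N <= n)%N -> B <= npow al n.
Proof.
have [N N0 HN] := nat_above (`|B| `^ al^-1); exists N => n Nn.
apply: le_trans (ler_norm B) _.
rewrite -[X in X <= _](powRr1 (normr_ge0 B)) -(mulVf (lt0r_neq0 al0)).
rewrite powRrM /npow ge0_ler_powR ?nnegrE ?powR_ge0 ?(ltW al0)//.
exact: HN.
Qed.

Lemma Tseq_cvg0 x : sqsum x -> Tseq x @ \oo --> (0 : R).
Proof.
move=> sx; apply/cvgrPdist_lt => e e0.
have := ip_tailseq_cvg0 sx => /(cvgMl_tmp (a := tail_const al)); rewrite mulr0.
move/cvgrPdist_lt => /(_ (e ^+ 2)); rewrite exprn_gt0// => /(_ isT)[N _ HN].
exists N => // n /= Nn; rewrite sub0r normrN.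
rewrite -(@ltr_pXn2r _ 2)// ?nnegrE ?(ltW e0)// real_normK ?num_real//.
have := HN n.+1 (leq_trans Nn (leqnSn _)); rewrite /= sub0r normrN.
apply: le_lt_trans; apply: le_trans (ler_norm _).
apply: le_trans (tail_sum_decay al0 n.+1 sx).
rewrite /Tseq exprMn ler_wpM2r ?sqr_ge0// ler_pXn2r ?nnegrE ?npow_ge0//.
exact: npow_le.
Qed.

Lemma slope_sum_diff x N n : sqsum x -> (N <= n)%N ->
  (slope_sum x n - slope_sum x N) ^+ 2 <=
    npow al n ^+ 2 * ip (tailseq N (hardy_op x)) (tailseq N (hardy_op x)).
Proof.
move=> sx Nn; have sA := sqsum_hardy_op al0 sx.
have dE k : wstep k * tail_sum k x = hardy_op x k * Num.sqrt (wstep k).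
  by rewrite /hardy_op mulrAC -expr2 sqr_sqrtr// ltW// wstep_gt0.
rewrite /slope_sum; under eq_bigr do rewrite dE;
  under [X in _ - X]eq_bigr do rewrite dE.
rewrite -(sum_tailseq (hardy_op x) (fun k => Num.sqrt (wstep k)) Nn).
apply: le_trans (sum_CS (tailseq N (hardy_op x)) (fun k => Num.sqrt (wstep k)) n) _.
under [X in _ * X <= _]eq_bigr do rewrite sqr_sqrtr ?(ltW (wstep_gt0 al0 _))//.
rewrite sum_wstep// mulrC ler_wpM2l ?sqr_ge0//; apply: le_ip.
exact: sqsum_tailseq.
Qed.

(** A Cesaro-type argument: beyond N the sum is at most n^al times the norm of
    the tail of the Hardy transform, and the part before N is divided by n^al. *)
Lemma Yseq_cvg0 x : sqsum x -> Yseq x @ \oo --> (0 : R).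
Proof.
move=> sx; have sA := sqsum_hardy_op al0 sx.
apply/cvgrPdist_lt => e e0; have e20 : 0 < e / 2 by rewrite divr_gt0.
have /cvgrPdist_lt/(_ ((e / 2) ^+ 2)) := ip_tailseq_cvg0 sA.
rewrite exprn_gt0// => /(_ isT)[N _ HN].
have := HN N (leqnn N); rewrite /= sub0r normrN => tN.
have {}tN := le_lt_trans (ler_norm _) tN.
have [N2 HN2] := npow_unbounded (`|slope_sum x N| / (e / 2)).
exists (maxn N N2) => // n /=; rewrite geq_max => /andP[Nn N2n].
rewrite sub0r normrN; have pn := npow_gt0 al n.
have h1 : `|slope_sum x n.+1 - slope_sum x N| < npow al n.+1 * (e / 2).
  rewrite -(@ltr_pXn2r _ 2)// ?nnegrE ?mulr_ge0 ?(ltW pn) ?(ltW e0)//.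
  rewrite real_normK ?num_real// exprMn.
  apply: le_lt_trans (slope_sum_diff sx (leq_trans Nn (leqnSn _))) _.
  by rewrite ltr_pM2l// exprn_gt0.
have h2 : `|slope_sum x N| <= npow al n.+1 * (e / 2).
  by rewrite -ler_pdivrMr// HN2// (leq_trans N2n).
rewrite /Yseq normrM normfV (gtr0_norm pn) ltr_pdivrMr//.
have -> : slope_sum x n.+1 =
  (slope_sum x n.+1 - slope_sum x N) + slope_sum x N by rewrite subrK.
apply: le_lt_trans (ler_normD _ _) _.
by move: h1 h2; rewrite mulrC; move: (npow al n.+1) => P; clear; lra.
Qed.

(** With rho = ((N + 1) / N)^al the recurrence is exactly
    Y' = Y / rho + (rho - 1 / rho) T and T' = rho T - Y' / (l (N + 1)); it remains
    to expand rho and 1 / rho to second order. *)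
Lemma flow_of_eigenpair l x : 0 < l -> sqsum x -> eigen_eq al l x ->
  exists K, exists2 N : nat, 0 <= K & perturbed_flow al l K N (Yseq x) (Tseq x).
Proof.
move=> l0 sx rx.
have [K1 [N1 K10 H1]] := npow_ratio_second_order al.
have [K2 [N2 K20 H2]] := npow_ratio_second_order (- al).
pose K := K1 + K2.
have K0 : 0 < K by rewrite addr_gt0.
pose D := K + (2 * al + 2 * K + 1) / l + 2 * K.
exists D, (maxn N1 N2).
  by rewrite /D; nonneg.
move=> m; rewrite geq_max => /andP[m1 m2].
have [r1 _] := H1 m m1; have [r2 _] := H2 m m2.
pose rho := npow al m.+2 / npow al m.+1.
have pm1 := npow_gt0 al m; have pm2 := npow_gt0 al m.+1.
have rhoV : npow (- al) m.+2 / npow (- al) m.+1 = rho^-1.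
  by rewrite /rho /npow !powRN -invfM.
set t := m.+1%:R^-1 in r1 r2 *.
have t0 : 0 < t by rewrite invr_gt0.
have t1 : t <= 1 by rewrite invf_le1// ler1n.
have {}r1 : `|rho - 1 - al * t| <= K * t ^+ 2.
  by apply: le_trans r1 _; rewrite ler_wpM2r ?sqr_ge0// lerDl ltW.
have {}r2 : `|rho^-1 - 1 + al * t| <= K * t ^+ 2.
  rewrite -rhoV; move: r2; rewrite mulNr opprK => r2; apply: le_trans r2 _.
  by rewrite ler_wpM2r ?sqr_ge0// lerDr ltW.
set y := Yseq x m; set u := Tseq x m.
have yE : Yseq x m.+1 = rho^-1 * y + (rho - rho^-1) * u.
  rewrite /y /u /Yseq /Tseq /slope_sum big_ord_recr /= -/(slope_sum x m.+1) /rho /wstep.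
  by field; rewrite !gt_eqF.
have uE : Tseq x m.+1 = rho * u - Yseq x m.+1 / (l * m.+2%:R).
  rewrite /u /Tseq.
  have -> : tail_sum m.+2 x = tail_sum m.+1 x - vweight m.+1 * x m.+1.
    by rewrite -tail_sum_step//; ring.
  have -> : x m.+1 = vweight m.+1 * slope_sum x m.+2 / l.
    by rewrite -rx mulrAC divff ?mul1r ?gt_eqF.
  have -> : vweight m.+1 * (vweight m.+1 * slope_sum x m.+2 / l) =
    vweight m.+1 ^+ 2 * slope_sum x m.+2 / l by ring.
  rewrite vweight_sq /Yseq /rho; have : (0 : R) < m.+2%:R by [].
  move: m.+2%:R => q q0.
  by field; rewrite !gt_eqF.
set y' := Yseq x m.+1 in yE uE *; set u' := Tseq x m.+1 in uE *.
clearbody y u y' u'.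
set M := `|y| + `|u|.
have My : `|y| <= M by rewrite lerDl.
have Mu : `|u| <= M by rewrite lerDr.
have M0 : 0 <= M by rewrite addr_ge0.
have Kt0 : 0 <= K * t ^+ 2 by rewrite mulr_ge0 ?sqr_ge0// ltW.
have ey : `|y' - y - t * (2 * al * u - al * y)| <= 2 * (K * t ^+ 2 * M).
  have -> : y' - y - t * (2 * al * u - al * y) =
    (rho^-1 - 1 + al * t) * (y - u) + (rho - 1 - al * t) * u by rewrite yE; ring.
  apply: le_trans (ler_normD _ _) _; rewrite !normrM.
  apply: le_trans (_ : K * t ^+ 2 * M + K * t ^+ 2 * M <= _);
    last by rewrite -mulr2n mulr_natl.
  have yu : `|y - u| <= M by exact: ler_normB.
  by apply: lerD; apply: ler_pM.
have tt : t ^+ 2 <= t by rewrite expr2 ger_pMr.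
have li0 : 0 < l^-1 by rewrite invr_gt0.
split.
  apply: le_trans ey _; rewrite mulrA ler_wpM2r// mulrA ler_wpM2r ?sqr_ge0//.
  by rewrite /D lerDr; nonneg.
have dy : `|y' - y| <= t * (2 * al + 2 * K) * M.
  have -> : y' - y = (y' - y - t * (2 * al * u - al * y)) + t * (2 * al * u - al * y).
    by rewrite subrK.
  apply: le_trans (ler_normD _ _) _.
  have h1 : 2 * (K * t ^+ 2 * M) <= t * (2 * K) * M.
    rewrite mulrA ler_wpM2r// mulrA [leRHS]mulrC ler_pM2l//.
    by rewrite mulr_gt0.
  have h2 : `|t * (2 * al * u - al * y)| <= t * (2 * al) * M.
    rewrite normrM (gtr0_norm t0) -[leRHS]mulrA ler_pM2l//.
    apply: le_trans (ler_normB _ _) _; rewrite !normrM (gtr0_norm al0) ger0_norm//.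
    rewrite /M mulrDr addrC lerD2r ler_wpM2r// ler_peMl ?ler1n//; exact: ltW.
  by apply: le_trans (lerD (le_trans ey h1) h2) _; rewrite -mulrDl -mulrDr addrC.
have sE : m.+2%:R^-1 = t - t * m.+2%:R^-1.
  rewrite /t -[m.+2%:R]natr1; have : (0 : R) < m.+1%:R by [].
  by move: m.+1%:R => q q0; field; rewrite !gt_eqF//; lra.
have st : m.+2%:R^-1 <= t by rewrite lef_pV2 ?posrE// ler_nat.
have s0 : (0 : R) < m.+2%:R^-1 by rewrite invr_gt0.
have -> : u' - u - t * (al * u - y / l) = (rho - 1 - al * t) * u
   - (y' - y) * (m.+2%:R^-1 * l^-1) + y * (t * m.+2%:R^-1 * l^-1).
  rewrite uE invfM.
  have -> : y * (t * m.+2%:R^-1 * l^-1) = y * ((t - m.+2%:R^-1) * l^-1).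
    by rewrite [in RHS]sE; ring.
  by ring.
apply: le_trans (ler_normD _ _) _; apply: le_trans (lerD (ler_normB _ _) (lexx _)) _.
have n1 : `|(rho - 1 - al * t) * u| <= K * t ^+ 2 * M by rewrite normrM ler_pM.
have n2 : `|(y' - y) * (m.+2%:R^-1 * l^-1)| <= (t * (2 * al + 2 * K) * M) * (t * l^-1).
  rewrite normrM; apply: ler_pM => //.
  by rewrite ger0_norm ?ler_pM2r// mulr_ge0// ltW.
have n3 : `|y * (t * m.+2%:R^-1 * l^-1)| <= M * (t * t * l^-1).
  rewrite normrM; apply: ler_pM => //.
  by rewrite ger0_norm ?ler_pM2r ?ler_pM2l// !mulr_ge0// ltW.
apply: le_trans (lerD (lerD n1 n2) n3) _.
have -> : D * t ^+ 2 * M = (K * t ^+ 2 * M + t * (2 * al + 2 * K) * M * (t / l) +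
    M * (t * t / l)) + 2 * (K * t ^+ 2 * M) by rewrite /D; ring.
by rewrite lerDl mulr_ge0// mulr_ge0.
Qed.

(** The recurrence can be run backwards. *)
Lemma zero_of_flow_zero l x N : sqsum x -> l != 0 -> eigen_eq al l x ->
  (forall n, (N <= n)%N -> `|Yseq x n| + `|Tseq x n| = 0) -> x = 0.
Proof.
move=> sx l0 rx H.
have tail n : (N < n)%N -> slope_sum x n = 0 /\ tail_sum n x = 0.
  case: n => // n Nn; have /eqP := H n Nn.
  rewrite paddr_eq0// !normr_eq0 => /andP[].
  rewrite /Yseq /Tseq !mulf_eq0 invr_eq0 (gt_eqF (npow_gt0 al n)) /= orbF.
  by move=> /eqP -> /eqP ->.
have xz n : slope_sum x n.+1 = 0 -> x n = 0.
  move=> P0; have := rx n; rewrite -/(slope_sum x n.+1) P0 mulr0 => /eqP.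
  by rewrite mulf_eq0 (negbTE l0) => /eqP.
have down k : (k <= N.+1)%N -> slope_sum x (N.+1 - k) = 0 /\ tail_sum (N.+1 - k) x = 0.
  elim: k => [|k IH] kN; first by rewrite subn0; exact: tail.
  have [] := IH (ltnW kN); rewrite -[(N.+1 - k)%N]prednK ?subn_gt0// -subnS.
  set i := (N.+1 - k.+1)%N => P0 S0; have x0 := xz _ P0.
  have Si : tail_sum i x = 0.
    by have := tail_sum_step al0 i sx; rewrite x0 S0 mulr0 subr0.
  by split=> //; move: P0; rewrite /slope_sum big_ord_recr /= Si mulr0 addr0.
apply/funext => n; apply: xz.
have [Nn|nN] := ltnP N n.+1; first by have [] := tail _ Nn.
by have [] := down (N.+1 - n.+1)%N (leq_subr _ _); rewrite subKn// ltnW.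
Qed.

(** An eigenvector gives a decaying solution of the perturbed flow, which is
    eventually zero when l <= 2 / al. *)
Lemma eigenvalue_above_threshold l x : eigenpair al l x -> 2 / al < l.
Proof.
move=> ex; have [sx x0 rx] := ex; have l0 := eigenpair_gt0 al0 ex.
rewrite ltNge; apply/negP => lle.
have [K [N K0 flow]] := flow_of_eigenpair l0 sx rx.
have Y0 := Yseq_cvg0 sx; have T0 := Tseq_cvg0 sx.
suff [N' HN'] : exists N' : nat, forall n, (N' <= n)%N -> `|Yseq x n| + `|Tseq x n| = 0.
  by apply: x0; apply: (zero_of_flow_zero sx _ rx HN'); rewrite gt_eqF.
move: lle; rewrite le_eqVlt => /predU1P[lE|llt].
  exact: parabolic_flow_zero lE K0 Y0 T0 flow.
exact: elliptic_flow_zero llt K0 Y0 T0 flow.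
Qed.

End Threshold.

(** * Matrix entries and Schur's test *)

Section Schur.
Variables (R : realType) (al : R).
Hypothesis al0 : 0 < al.
Implicit Types (x y h g : nat -> R) (n k N : nat) (l : R).

Local Notation vweight := (vweight al).
Local Notation wstep := (wstep al).
Local Notation tail_sum := (tail_sum al).
Local Notation hardy_op := (hardy_op al).
Local Notation qform := (qform al).
Local Notation unit_seq := (unit_seq R).

(** The Green matrix v_n v_m min(w_n, w_m). *)
Definition Kentry n m : R := vweight n * vweight m * npow al (minn n m).+1 ^+ 2.

Lemma tail_sum_unit k m : tail_sum k (unit_seq m) = if (k <= m)%N then vweight m else 0.
Proof. by rewrite /tail_sum ipC ip_unit. Qed.

Lemma qform_units n m : qform (unit_seq m) (unit_seq n) = Kentry n m.
Proof.
rewrite qform_unit//; last exact: sqsum_unit.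
rewrite /Kentry -mulrA; congr (_ * _).
transitivity (\sum_(k < n.+1 | (k <= m)%N) wstep k * vweight m).
  rewrite [RHS]big_mkcond /=; apply: eq_bigr => k _.
  by rewrite tail_sum_unit; case: ifP => // _; rewrite mulr0.
rewrite -mulr_suml mulrC; congr (_ * _).
rewrite -sum_wstep// (big_ord_widen_cond n.+1 xpredT) /=; last by rewrite ltnS geq_minl.
apply: eq_bigl => k; rewrite ltnS leq_min.
by have := ltn_ord k; rewrite ltnS => ->.
Qed.

Lemma Kentry_diag n : Kentry n n = n.+1%:R^-1.
Proof.
rewrite /Kentry minnn -expr2 vweight_sq invfM divfK//.
by rewrite expf_neq0// gt_eqF// npow_gt0.
Qed.

Lemma Kentry_ge0 n m : 0 <= Kentry n m.
Proof. by rewrite mulr_ge0 ?exprn_ge0 ?npow_ge0// mulr_ge0// ltW// vweight_gt0. Qed.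

Lemma KentryC n m : Kentry n m = Kentry m n.
Proof. by rewrite /Kentry minnC (mulrC (vweight n)). Qed.

(** The off-diagonal entries weighted by the test vector N^(-1/2) of Schur's
    test. *)
Definition schur_entry n m : R :=
  if n == m then 0 else Kentry n m * (Num.sqrt n.+1%:R / Num.sqrt m.+1%:R).

Lemma sqrtS_gt0 n : 0 < Num.sqrt n.+1%:R :> R. Proof. by rewrite sqrtr_gt0. Qed.

Lemma schur_entry_lt n m : (m < n)%N ->
  schur_entry n m = npow al m.+1 / npow al n.+1 / m.+1%:R.
Proof.
move=> mn; rewrite /schur_entry gtn_eqF// /Kentry (minn_idPr (ltnW mn)) /vweight.
rewrite -[in RHS](@sqr_sqrtr _ m.+1%:R)//.
have := sqrtS_gt0 n; have := sqrtS_gt0 m; have := npow_gt0 al n; have := npow_gt0 al m.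
move: (npow al n.+1) (npow al m.+1) (Num.sqrt _) (Num.sqrt _) => p q r s p0 q0 r0 s0.
by field; rewrite !gt_eqF.
Qed.

Lemma schur_entry_gt n m : (n < m)%N ->
  schur_entry n m = npow al n.+1 * (m.+1%:R * npow al m.+1)^-1.
Proof.
move=> mn; rewrite /schur_entry ltn_eqF// /Kentry (minn_idPl (ltnW mn)) /vweight.
rewrite -[in RHS](@sqr_sqrtr _ m.+1%:R)//.
have := sqrtS_gt0 n; have := sqrtS_gt0 m; have := npow_gt0 al n; have := npow_gt0 al m.
move: (npow al n.+1) (npow al m.+1) (Num.sqrt _) (Num.sqrt _) => p q r s p0 q0 r0 s0.
by field; rewrite !gt_eqF.
Qed.

(** Left of the diagonal the terms are bounded by increments of N^al, right of
    it by decrements of N^(-al); both branches have the form that the induction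
    on N needs. *)
Lemma row_partial n N : \sum_(m < N) schur_entry n m <=
  if (N <= n)%N then 2 / al * (npow al N.+1 / npow al n.+1)
  else 3 / al - al^-1 * (npow al n.+1 / npow al N).
Proof.
have pn := npow_gt0 al n.
elim: N => [|N IH].
  by rewrite big_ord0 leq0n; apply: mulr_ge0; apply: divr_ge0;
    rewrite ?npow_ge0 ?(ltW al0).
rewrite big_ord_recr /=; case: (ltngtP N n) => Nn.
- rewrite (ltnW Nn) in IH; apply: le_trans (lerD IH (lexx _)) _.
  rewrite schur_entry_lt// -lerBrDl -mulrBr -mulrBl.
  rewrite mulrAC mulrA ler_pM2r ?invr_gt0//.
  have := npow_increment N al0; rewrite -ler_pdivlMl// => H.
  apply: le_trans (_ : 2 * (npow al N.+1 / N.+2%:R) <= _).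
    rewrite mulrCA ler_wpM2l ?npow_ge0// -[2 in leRHS]invrK -invfM lef_pV2 ?posrE
      ?mulr_gt0 ?invr_gt0//.
    by rewrite ler_pdivrMl// -natrM ler_nat mul2n -addnn addnS addSn !ltnS leq_addr.
  by rewrite -mulrA ler_pM2l.
- rewrite leqNgt Nn /= in IH; apply: le_trans (lerD IH (lexx _)) _.
  rewrite schur_entry_gt//; case: N Nn {IH} => // N Nn.
  have := npow_tail_term N al0; rewrite -(ler_pM2l pn) => H.
  apply: le_trans (lerD (lexx _) H) _.
  by rewrite le_eqVlt; apply/orP; left; apply/eqP; ring.
- rewrite Nn leqnn in IH; rewrite Nn /schur_entry eqxx addr0.
  apply: le_trans IH _; rewrite divff ?gt_eqF// !mulr1.
  by rewrite le_eqVlt; apply/orP; left; apply/eqP; ring.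
Qed.

Lemma row_bound n N : \sum_(m < N) schur_entry n m <= 3 / al.
Proof.
have pn := npow_gt0 al n.
apply: le_trans (row_partial n N) _; case: ifPn => [Nn|_].
  apply: le_trans (_ : 2 / al * 1 <= _).
    rewrite ler_pM2l ?divr_gt0// ler_pdivrMr// mul1r; exact: npow_le.
  by rewrite mulr1 ler_pM2r ?invr_gt0// ler_nat.
by rewrite gerBl mulr_ge0 ?invr_ge0 ?(ltW al0)// divr_ge0// npow_ge0.
Qed.

(** The arithmetic-geometric mean inequality splits each off-diagonal product
    into two squares, and symmetry makes the two resulting sums equal. *)
Lemma schur_fin N x :
  `|\sum_(n < N) \sum_(m < N) x n * x m * Kentry n m - \sum_(n < N) x n ^+ 2 / n.+1%:R|
    <= 3 / al * \sum_(n < N) x n ^+ 2.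
Proof.
pose a n m : R := if n == m then 0 else Kentry n m.
have -> : \sum_(n < N) \sum_(m < N) x n * x m * Kentry n m - \sum_(n < N) x n ^+ 2 /
  n.+1%:R =
  \sum_(n < N) \sum_(m < N) x n * x m * a n m.
  rewrite -sumrB; apply: eq_bigr => n _; rewrite (bigD1 n)//= [RHS](bigD1 n)//=.
  rewrite Kentry_diag -expr2 {1}/a eqxx mulr0 add0r addrAC subrr add0r.
  by apply: eq_bigr => m mn; rewrite /a eq_sym (negbTE (mn : (m : nat) != n)).
pose s := \sum_(n < N) \sum_(m < N) x n ^+ 2 * schur_entry n m.
have sE : s <= 3 / al * \sum_(n < N) x n ^+ 2.
  rewrite /s mulr_sumr; apply: ler_sum => n _; rewrite -mulr_sumr mulrC.
  by rewrite ler_wpM2r ?sqr_ge0// row_bound.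
apply: le_trans sE.
have -> : s = \sum_(n < N) \sum_(m < N) (x n ^+ 2 * schur_entry n m + x m ^+ 2 *
  schur_entry m n) / 2.
  under [RHS]eq_bigr do rewrite -mulr_suml big_split /= mulrDl.
  rewrite big_split /= -!mulr_suml [X in _ + X / 2]exchange_big /= -/s.
  by field.
apply: le_trans (ler_norm_sum _ _ _) _; apply: ler_sum => n _.
apply: le_trans (ler_norm_sum _ _ _) _; apply: ler_sum => m _.
rewrite /a /schur_entry (eq_sym (m : nat)); case: eqP => _;
  first by rewrite !mulr0 normr0 addr0 mul0r.
rewrite (KentryC m n) normrM (ger0_norm (Kentry_ge0 _ _)).
have := sqrtS_gt0 n; have := sqrtS_gt0 m.
move: (Num.sqrt _) (Num.sqrt _) => q p p0 q0.
have -> : (x n ^+ 2 * (Kentry n m * (q / p)) + x m ^+ 2 * (Kentry n m * (p / q))) / 2 =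
  (x n ^+ 2 * (q / p) + x m ^+ 2 * (p / q)) / 2 * Kentry n m by ring.
rewrite ler_wpM2r ?Kentry_ge0//.
have h (e : R) : e = 1 \/ e = -1 ->
  e * (x n * x m) <= (x n ^+ 2 * (q / p) + x m ^+ 2 * (p / q)) / 2.
  move=> He; rewrite -subr_ge0.
  have -> : (x n ^+ 2 * (q / p) + x m ^+ 2 * (p / q)) / 2 - e * (x n * x m) =
    ((q * x n - e * p * x m) ^+ 2 + (1 - e ^+ 2) * p ^+ 2 * x m ^+ 2) / (2 * p * q).
    by field; rewrite !gt_eqF.
  have -> : 1 - e ^+ 2 = 0 by case: He => ->; rewrite ?sqrrN expr1n subrr.
  by rewrite !mul0r addr0 divr_ge0 ?sqr_ge0// !mulr_ge0// ltW.
rewrite ler_norml lerNl; apply/andP; split.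
  by have := h (-1) (or_intror erefl); rewrite mulN1r.
by have := h 1 (or_introl erefl); rewrite mul1r.
Qed.

(** Heads are finite combinations of coordinate vectors, on which the form is
    given by the matrix entries. *)
Lemma head_sum N x : x - tailseq N x = \sum_(i < N) x i *: unit_seq i.
Proof.
apply/funext => n; rewrite fct_sumE.
have -> : (x - tailseq N x) n = x n - tailseq N x n by [].
transitivity (if (n < N)%N then x n else 0).
  by rewrite /tailseq ltnNge; case: ifP => _; rewrite ?subrr ?subr0.
rewrite -sum_unit; apply: eq_bigr => i _.
by have -> : (x i *: unit_seq i) n = x i * (n == i)%:R by []; rewrite eq_sym.
Qed.

Lemma qform_bounded : exists2 C, 0 <= C & forall x, sqsum x -> qform x x <= C * ip x x.
Proof.
have [M HM] := hardy al0.
have s0 : 0 <= \sum_(k < M) wstep k * ip (tailseq k vweight) (tailseq k vweight).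
  apply: sumr_ge0 => k _; rewrite mulr_ge0 ?ip_ge0 ?(ltW (wstep_gt0 al0 _))//.
  exact: sqsum_tailseq_vweight.
exists (2 / al + \sum_(k < M) wstep k * ip (tailseq k vweight) (tailseq k vweight)).
  by rewrite addr_ge0// divr_ge0// ltW.
move=> x sx; apply: le_trans (HM x sx) _; rewrite [leRHS]mulrDl;
  apply: lerD (lexx _) _; rewrite mulr_suml.
apply: ler_sum => k _; rewrite -mulrA ler_wpM2l ?(ltW (wstep_gt0 al0 _))//.
by rewrite mulrC; exact: tail_sum_sq_le.
Qed.

Lemma qform_CS x y : sqsum x -> sqsum y -> qform x y ^+ 2 <= qform x x * qform y y.
Proof. by move=> sx sy; apply: ip_CS; exact: sqsum_hardy_op. Qed.

Lemma qform_tailseq_cvg0 x : sqsum x ->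
  (fun N => qform (tailseq N x) (tailseq N x)) @ \oo --> (0 : R).
Proof.
move=> sx; have [C C0 HC] := qform_bounded.
have lim : (fun N => C * ip (tailseq N x) (tailseq N x)) @ \oo --> (0 : R).
  by rewrite -(mulr0 C); apply: cvgMl_tmp; exact: ip_tailseq_cvg0.
apply: (squeeze_cvgr _ (cvg_cst 0) lim); apply: filterE => N.
by rewrite (qform_ge0 al0 (sqsum_tailseq N sx)) HC//; exact: sqsum_tailseq.
Qed.

Lemma qform_tailseq_cross_cvg0 x h : sqsum x -> sqsum h ->
  (fun N => qform (tailseq N x) h) @ \oo --> (0 : R).
Proof.
move=> sx sh; apply/cvgrPdist_lt => e e0.
have lim : (fun N => qform (tailseq N x) (tailseq N x) * qform h h) @ \oo --> (0 : R).
  by rewrite -(mul0r (qform h h)); apply: cvgMr_tmp; exact: qform_tailseq_cvg0.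
move/cvgrPdist_lt: lim => /(_ (e ^+ 2)); rewrite exprn_gt0// => /(_ isT)[N _ HN].
exists N => // n /= Nn; have := HN n Nn; rewrite /= !sub0r !normrN => H.
rewrite -(@ltr_pXn2r _ 2)// ?nnegrE ?(ltW e0)// real_normK ?num_real//.
apply: le_lt_trans H; apply: le_trans (ler_norm _).
by apply: qform_CS => //; exact: sqsum_tailseq.
Qed.

Lemma qform_headl N x h : sqsum x -> sqsum h ->
  qform (x - tailseq N x) h = qform x h - qform (tailseq N x) h.
Proof.
move=> sx sh; have st := sqsum_tailseq N sx.
rewrite -scaleN1r /qform hardy_opD ?hardy_opZ//; last exact: sqsumZ.
rewrite ipDl ?ipZl ?mulN1r//; try exact: sqsum_hardy_op.
by apply: sqsumZ; exact: sqsum_hardy_op.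
Qed.

Lemma qform_head_units N x h : sqsum h ->
  qform (x - tailseq N x) h = \sum_(i < N) x i * qform (unit_seq i) h.
Proof. by move=> sh; rewrite head_sum qform_suml// => i; exact: sqsum_unit. Qed.

(** This identifies the form with the action of the matrix by convergent
    series. *)
Lemma qform_unit_cvg x n : sqsum x ->
  (fun N => \sum_(m < N) Kentry n m * x m) @ \oo --> qform x (unit_seq n).
Proof.
move=> sx; have sn := sqsum_unit R n.
rewrite (_ : (fun N => _) =
  fun N => qform x (unit_seq n) - qform (tailseq N x) (unit_seq n)).
  rewrite -[X in _ --> X]subr0; apply: cvgB; first exact: cvg_cst.
  exact: qform_tailseq_cross_cvg0.
apply/funext => N; rewrite -qform_headl// qform_head_units//; apply: eq_bigr => i _.
by rewrite qform_units mulrC.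
Qed.

Lemma qform_head2 N x : qform (x - tailseq N x) (x - tailseq N x) =
  \sum_(n < N) \sum_(m < N) x n * x m * Kentry n m.
Proof.
have sh : sqsum (x - tailseq N x) by rewrite head_sum; apply: sqsum_sum => i;
  exact: sqsum_unit.
rewrite qform_head_units//; apply: eq_bigr => n _.
rewrite qformC qform_head_units ?mulr_sumr//; last exact: sqsum_unit.
by apply: eq_bigr => m _; rewrite qform_units mulrA.
Qed.

Lemma qform_head2_cvg x : sqsum x ->
  (fun N => \sum_(n < N) \sum_(m < N) x n * x m * Kentry n m) @ \oo --> qform x x.
Proof.
move=> sx.
rewrite (_ : (fun N => _) =
  fun N => qform x x - 2 * qform (tailseq N x) x + qform (tailseq N x) (tailseq N x)).
  rewrite -[X in _ --> X](_ : qform x x - 2 * 0 + 0 = _);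
    last by rewrite mulr0 subr0 addr0.
  apply: cvgD; last exact: qform_tailseq_cvg0.
  apply: cvgB; first exact: cvg_cst.
  by apply: cvgMl_tmp; exact: qform_tailseq_cross_cvg0.
apply/funext => N; rewrite -qform_head2 -scaleN1r qform_expand//;
  last exact: sqsum_tailseq.
by rewrite (qformC al x); ring.
Qed.

Lemma qform_upper j x : sqsum x -> (forall n, (n < j)%N -> x n = 0) ->
  qform x x <= (j.+1%:R^-1 + 3 / al) * ip x x.
Proof.
move=> sx xz.
apply: ler_cvg_to (qform_head2_cvg sx) (cvg_cst _) _; apply: filterE => N.
have := schur_fin N x; rewrite ler_norml => /andP[_]; rewrite lerBlDl => H.
apply: le_trans H _; rewrite [leRHS]mulrDl; apply: lerD; last first.
  by rewrite ler_wpM2l ?le_ip// divr_ge0// ltW.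
apply: le_trans (_ : j.+1%:R^-1 * \sum_(n < N) x n ^+ 2 <= _); last first.
  by rewrite ler_wpM2l ?le_ip// invr_ge0.
rewrite mulr_sumr; apply: ler_sum => n _.
have [nj|jn] := ltnP n j; first by rewrite xz// expr0n mul0r mulr0.
by rewrite mulrC ler_wpM2r ?sqr_ge0// lef_pV2 ?posrE// ler_nat.
Qed.

Lemma qform_lower j x : sqsum x -> tailseq j x = 0 ->
  (j%:R^-1 - 3 / al) * ip x x <= qform x x.
Proof.
move=> sx xz; have xE : x = x - tailseq j x by rewrite xz subr0.
have ipE : ip x x = \sum_(n < j) x n ^+ 2.
  have := ip_tailseq2 j sx; rewrite xz ip0l => /esym/eqP.
  by rewrite subr_eq0 => /eqP.
rewrite [in leRHS]xE qform_head2 ipE.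
have := schur_fin j x; rewrite ler_norml => /andP[H _].
rewrite mulrBl; apply: le_trans (_ : \sum_(n < j) x n ^+ 2 / n.+1%:R -
   3 / al * \sum_(n < j) x n ^+ 2 <= _).
  rewrite lerD2r mulr_sumr; apply: ler_sum => n _.
  rewrite mulrC ler_wpM2l ?sqr_ge0// lef_pV2 ?posrE ?ler_nat//.
  by rewrite ltr0n (leq_trans _ (ltn_ord n)).
by move: H; rewrite lerNl opprB lerBlDl lerBlDr addrC.
Qed.

End Schur.

(** * Monotonicity of tanh(t)/t *)

Section HyperbolicTangent.
Variable R : realType.
Implicit Types a b t : R.

(** Weighted arithmetic-geometric mean inequality for expR X and 1: the
    combination of two tangent inequalities at th X. *)
Lemma expR_AMGM (th X : R) : 0 <= th -> th <= 1 ->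
  expR (th * X) <= th * expR X + (1 - th).
Proof.
move=> th0 th1; set E := expR (th * X); have E0 : 0 < E by exact: expR_gt0.
have h1 : E * (1 + (1 - th) * X) <= expR X.
  have -> : expR X = E * expR ((1 - th) * X) by rewrite -expRD; congr expR; ring.
  by rewrite ler_pM2l// expR_ge1Dx.
have h2 : E * (1 + - (th * X)) <= 1.
  have {2}-> : 1 = E * expR (- (th * X)) by rewrite -expRD subrr expR0.
  by rewrite ler_pM2l// expR_ge1Dx.
have h3 : th * (E * (1 + (1 - th) * X)) + (1 - th) * (E * (1 + - (th * X))) = E by ring.
rewrite -h3; apply: lerD; first by rewrite ler_wpM2l.
by rewrite -[leRHS]mulr1 ler_wpM2l// subr_ge0.
Qed.

(** After division by expR ((a + b) t) this is the concavity of 1 - expR (- s)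
    at s = a t and s = b t. *)
Lemma expR_pair_ge0 a b t : 0 < a -> a <= b ->
  0 <= (b - a) * expR ((a + b) * t) + a * expR (a * t) - b * expR (b * t).
Proof.
move=> a0 ab; have b0 : 0 < b by exact: lt_le_trans ab.
have th1 : a / b <= 1 by rewrite ler_pdivrMr// mul1r.
have th0 : 0 <= a / b by rewrite divr_ge0// ltW.
have := expR_AMGM (- (b * t)) th0 th1.
have -> : a / b * - (b * t) = - (a * t) by field; rewrite gt_eqF.
rewrite !expRN (mulrDl a b) expRD.
have := expR_gt0 (a * t); have := expR_gt0 (b * t).
move: (expR (a * t)) (expR (b * t)) => A B B0 A0.
rewrite -subr_ge0.
have -> : a / b * B^-1 + (1 - a / b) - A^-1 =
  ((b - a) * (A * B) + a * A - b * B) / (b * A * B).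
  by field; rewrite !gt_eqF.
by rewrite pmulr_lge0// invr_gt0 !mulr_gt0.
Qed.

(** The function vanishes at 0, and its derivative is a + b times the quantity
    of [expR_pair_ge0]. *)
Lemma tanh_numerator_ge0 a b t : 0 < a -> a <= b -> 0 <= t ->
  0 <= (b - a) * (expR ((a + b) * t) - 1) + (a + b) * (expR (a * t) - expR (b * t)).
Proof.
move=> a0 ab t0.
pose f : R -> R := (b - a) \*: (expR \o ((a + b) \*: id)) +
  (a + b) \*: ((expR \o (a \*: id)) - (expR \o (b \*: id))).
pose df (s : R) := (a + b) *
  ((b - a) * expR ((a + b) * s) + a * expR (a * s) - b * expR (b * s)).
have fd (s : R) : is_derive s (1 : R) f (df s).
  have dlin (c : R) : is_derive s (1 : R) (c \*: id : R ->
    R) (c *: 1) by exact: is_deriveZ.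
  have dexp (c : R) : is_derive s (1 : R) (expR \o (c \*: id : R ->
    R)) (expR (c * s) * (c *: 1)).
    by apply: is_derive1_comp.
  have : is_derive s (1 : R) f ((b - a) *: (expR ((a + b) * s) * ((a + b) *: 1)) +
     (a + b) *: ((expR (a * s) * (a *: 1)) - (expR (b * s) * (b *: 1)))).
    exact: is_deriveD.
  move=> H; apply: (is_derive_eq H); rewrite /df /GRing.scale /=; ring.
have cf : {within `[0, t], continuous f}.
  apply: continuous_subspaceT => s; apply/differentiable_continuous/derivable1_diffP.
  by have [] := fd s.
have [c _ fE] := @MVT_segment R f df 0 t t0 (fun s _ => fd s) cf.
have f0 : f 0 = b - a.
  rewrite /f; have -> : ((b - a) \*: (expR \o ((a + b) \*: id)) +
  (a + b) \*: ((expR \o (a \*: id)) - (expR \o (b \*: id)))) 0 =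
    (b - a) * expR ((a + b) * 0) + (a + b) * (expR (a * 0) - expR (b * 0)) by [].
  by rewrite !mulr0 expR0 subrr mulr0 addr0 mulr1.
have -> : (b - a) * (expR ((a + b) * t) - 1) + (a + b) * (expR (a * t) - expR (b *
  t)) = f t - f 0.
  rewrite f0 /f; have -> : ((b - a) \*: (expR \o ((a + b) \*: id)) +
  (a + b) \*: ((expR \o (a \*: id)) - (expR \o (b \*: id)))) t =
    (b - a) * expR ((a + b) * t) + (a + b) * (expR (a * t) - expR (b * t)) by [].
  by ring.
rewrite fE subr0 mulr_ge0// mulr_ge0 ?expR_pair_ge0//.
by rewrite addr_ge0 ?(ltW a0)// (le_trans (ltW a0)).
Qed.

(** With r^a = expR (2 u) the left factor is tanh u: this says that tanh(u) / u
    does not increase. Clearing denominators avoids differentiating a quotient. *)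
Lemma tanh_ratio_le a b (r : R) : 0 < a -> a <= b -> 1 < r ->
  (r `^ b - 1) / (r `^ b + 1) / b <= (r `^ a - 1) / (r `^ a + 1) / a.
Proof.
move=> a0 ab r1; have r0 : 0 < r by exact: lt_trans r1.
have b0 : 0 < b by exact: lt_le_trans ab.
have := tanh_numerator_ge0 a0 ab (ltW (ln_gt0 r1)).
rewrite /powR gt_eqF// (mulrDl a b) expRD.
have := expR_gt0 (a * ln r); have := expR_gt0 (b * ln r).
move: (expR (a * ln r)) (expR (b * ln r)) => A B B0 A0 H.
have A1 : 0 < A + 1 by rewrite addr_gt0.
have B1 : 0 < B + 1 by rewrite addr_gt0.
rewrite -subr_ge0.
have -> : (A - 1) / (A + 1) / a - (B - 1) / (B + 1) / b =
  ((b - a) * (A * B - 1) + (a + b) * (A - B)) / ((A + 1) * (B + 1) * a * b).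
  by field; rewrite !gt_eqF.
by rewrite divr_ge0// !mulr_ge0// ltW.
Qed.

End HyperbolicTangent.

(** * The inverse form and its dependence on the parameter *)

Section Monotonicity.
Variable R : realType.
Implicit Types (al a b : R) (x : nat -> R) (n k N : nat).

Definition rescaled x n : R := Num.sqrt n.+1%:R * x n.
(** The solution g of x_n = v_n sum_(k <= n) (w_k - w_(k-1)) g_k. For an
    eigenvector it is the sequence of tail sums divided by the eigenvalue. *)
Definition inv_slope al x n : R :=
  (npow al n.+1 * rescaled x n - if n is k.+1 then npow al n * rescaled x k else 0) /
    wstep al n.
(** Partial sums of the inverse form <K^(-1) x, x>. *)
Definition inv_form al x N : R := \sum_(n < N) wstep al n * inv_slope al x n ^+ 2.

Lemma sum_inv_slope al x n : 0 < al ->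
  x n = vweight al n * \sum_(k < n.+1) wstep al k * inv_slope al x k.
Proof.
move=> al0.
have -> : \sum_(k < n.+1) wstep al k * inv_slope al x k = npow al n.+1 * rescaled x n.
  elim: n => [|n IH].
    by rewrite big_ord_recr big_ord0 /= add0r /inv_slope mulrC subr0 divfK// gt_eqF//
      wstep_gt0.
  rewrite big_ord_recr /= IH /inv_slope [X in _ + X]mulrC divfK ?gt_eqF ?wstep_gt0//.
  by rewrite addrC subrK.
rewrite /rescaled /vweight; have := sqrtS_gt0 R n; have := npow_gt0 al n.
move: (npow al n.+1) (Num.sqrt _) (x n) => p q z p0 q0.
by field; rewrite !gt_eqF.
Qed.

Lemma inv_slope_unique al x (h : nat -> R) n : 0 < al ->
  (forall n, x n = vweight al n * \sum_(k < n.+1) wstep al k * h k) ->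
    inv_slope al x n = h n.
Proof.
move=> al0 H.
have zE m : npow al m.+1 * rescaled x m = \sum_(k < m.+1) wstep al k * h k.
  rewrite /rescaled H /vweight; have := sqrtS_gt0 R m; have := npow_gt0 al m.
  move: (npow al m.+1) (Num.sqrt _) (\sum_(_ < _) _) => p q z p0 q0.
  by field; rewrite !gt_eqF.
have dn := wstep_gt0 al0 n; rewrite /inv_slope zE; case: n dn => [|n] dn.
  by rewrite big_ord_recr big_ord0 /= add0r subr0 mulrC mulKf ?gt_eqF.
by rewrite zE big_ord_recr /= addrAC subrr add0r mulrC mulKf ?gt_eqF.
Qed.

Definition rho al n : R := npow al n.+2 / npow al n.+1.

(** The base does not depend on al, which makes the dependence on al explicit. *)
Lemma rho_powR al n : rho al n = (n.+2%:R / n.+1%:R) `^ al.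
Proof. exact: npow_ratio. Qed.

Lemma base_gt1 n : 1 < n.+2%:R / n.+1%:R :> R.
Proof. by rewrite ltr_pdivlMr// mul1r ltr_nat. Qed.

Lemma rho_gt1 al n : 0 < al -> 1 < rho al n.
Proof. by move=> al0; rewrite /rho ltr_pdivlMr ?npow_gt0// mul1r npow_lt. Qed.

Lemma rho_lt a b n : a < b -> rho a n < rho b n.
Proof.
move=> ab; rewrite !rho_powR /powR gt_eqF ?divr_gt0// ltr_expR ltr_pM2r//.
by rewrite ln_gt0// base_gt1.
Qed.

(** Here rho = expR (2 u) with u = (al / 2) log ((N + 1) / N), so that the
    quotients are coth u and tanh u. *)
Definition coth_coef al n : R := (rho al n + 1) / (rho al n - 1) / al.
Definition tanh_coef al n : R := (rho al n - 1) / (rho al n + 1) / al.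

Lemma coth_coef_lt a b n : 0 < a -> a < b -> coth_coef b n < coth_coef a n.
Proof.
move=> a0 ab; have b0 : 0 < b by exact: lt_trans ab.
have ra := rho_gt1 n a0; have rb := rho_gt1 n b0; have rab := rho_lt n ab.
rewrite /coth_coef; move: ra rb rab; move: (rho a n) (rho b n) => A B A1 B1 AB.
have A0 : 0 < A - 1 by rewrite subr_gt0.
have B0 : 0 < B - 1 by rewrite subr_gt0.
rewrite -subr_gt0.
have -> : (A + 1) / (A - 1) / a - (B + 1) / (B - 1) / b =
  ((A + 1) * (B - 1) * (b - a) + 2 * a * (B - A)) / ((A - 1) * (B - 1) * a * b).
  by field; rewrite !gt_eqF.
rewrite divr_gt0 ?mulr_gt0// addr_gt0 ?mulr_gt0 ?subr_gt0//.
by rewrite addr_gt0// (lt_trans ltr01).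
Qed.

Lemma tanh_coef_le a b n : 0 < a -> a <= b -> tanh_coef b n <= tanh_coef a n.
Proof.
by move=> a0 ab; rewrite /tanh_coef !rho_powR; apply: tanh_ratio_le => //;
  exact: base_gt1.
Qed.

(** Each term splits as
    (q z' - p z)^2 / (q^2 - p^2) = (z'^2 - z^2) / 2
      + (coth u (z' - z)^2 + tanh u (z' + z)^2) / 4, q / p = expR (2 u),
    and the first part telescopes. The sequence z = [rescaled x] does not
    involve the parameter. *)
Lemma inv_form_hyperbolic al x N : 0 < al -> inv_form al x N.+1 / al =
  (rescaled x 0 ^+ 2 + rescaled x N ^+ 2) / 2 / al +
  \sum_(n < N) (coth_coef al n * (rescaled x n.+1 - rescaled x n) ^+ 2 +
                tanh_coef al n * (rescaled x n.+1 + rescaled x n) ^+ 2) / 4.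
Proof.
move=> al0; elim: N => [|N IH].
  rewrite /inv_form big_ord_recr !big_ord0 /= add0r addr0 /inv_slope /wstep npow1
    npow0// subr0.
  by field; rewrite gt_eqF.
rewrite /inv_form big_ord_recr /= mulrDl -/(inv_form al x N.+1) IH big_ord_recr /=.
have p1 := npow_gt0 al N; have p2 := npow_gt0 al N.+1.
have p12 : npow al N.+1 < npow al N.+2 by exact: npow_lt.
rewrite /inv_slope /wstep /coth_coef /tanh_coef /rho; move: (\sum_(_ < N) _) => s.
move: (rescaled x 0) (rescaled x N) (rescaled x N.+1) p1 p2 p12;
  move: (npow al N.+1) (npow al N.+2).
move=> p q z0 z1 z2 p0 q0 pq.
have d1 : 0 < q - p by rewrite subr_gt0.
have d2 : 0 < q + p by rewrite addr_gt0.
have -> : q ^+ 2 - p ^+ 2 = (q - p) * (q + p) by ring.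
have -> : q / p - 1 = (q - p) / p by field; rewrite gt_eqF.
have -> : q / p + 1 = (q + p) / p by field; rewrite gt_eqF.
by field; rewrite !gt_eqF.
Qed.

(** All coefficients are monotone; the gap d comes from the term at the first
    nonzero coordinate, where z' - z is not zero and the coefficient decreases
    strictly. *)
Lemma inv_form_antitone a b x : 0 < a -> a < b -> x <> 0 ->
  exists2 d : R, 0 < d & exists N0, forall N, (N0 <= N)%N ->
    inv_form b x N.+1 / b + d <= inv_form a x N.+1 / a.
Proof.
move=> a0 ab x0; have b0 : 0 < b by exact: lt_trans ab.
have iab : b^-1 < a^-1 by rewrite ltf_pV2.
have [n xn] : exists n, x n != 0.
  apply: contra_notP x0 => /forallNP H; apply/funext => n.
  by have /negP := H n; rewrite negbK => /eqP.
pose P n := x n != 0.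
have exP : exists n, P n by exists n.
case: (ex_minnP exP) => m Pm Hm.
have zm : 0 < rescaled x m ^+ 2.
  by rewrite lt0r sqr_ge0 sqrf_eq0 mulf_neq0// gt_eqF ?sqrtS_gt0.
pose g n := (coth_coef a n - coth_coef b n) * (rescaled x n.+1 - rescaled x n) ^+ 2 +
   (tanh_coef a n - tanh_coef b n) * (rescaled x n.+1 + rescaled x n) ^+ 2.
have g0 k : 0 <= g k.
  rewrite /g addr_ge0// mulr_ge0 ?sqr_ge0 ?subr_ge0//.
    exact/ltW/coth_coef_lt.
  exact/tanh_coef_le/ltW.
have diff N : inv_form a x N.+1 / a - inv_form b x N.+1 / b =
    (rescaled x 0 ^+ 2 + rescaled x N ^+ 2) / 2 * (a^-1 - b^-1) + (\sum_(n < N) g n)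
      / 4.
  rewrite !inv_form_hyperbolic// mulrBr opprD addrACA; congr (_ + _).
  rewrite -sumrB mulr_suml; apply: eq_bigr => k _; rewrite /g; ring.
have ab0 : 0 < a^-1 - b^-1 by rewrite subr_gt0.
suff [d d0 [N0 Hd]] : exists2 d : R, 0 < d & exists N0, forall N, (N0 <= N)%N ->
    d <= inv_form a x N.+1 / a - inv_form b x N.+1 / b.
  by exists d => //; exists N0 => N /Hd; rewrite lerBrDr addrC.
case: m Pm Hm zm => [|m] Pm Hm zm.
  exists (rescaled x 0 ^+ 2 / 2 * (a^-1 - b^-1)).
    by rewrite mulr_gt0// divr_gt0.
  exists 0%N => N _; rewrite diff mulrDl mulrDl -addrA lerDl addr_ge0//.
    by rewrite mulr_ge0 ?(ltW ab0)// divr_ge0// sqr_ge0.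
  by rewrite divr_ge0// sumr_ge0.
have zm0 : rescaled x m = 0.
  rewrite /rescaled (_ : x m = 0) ?mulr0//; apply/eqP; apply: contraT => Pm'.
  by have := Hm m Pm'; rewrite ltnn.
exists (g m / 4).
  rewrite divr_gt0// /g zm0 subr0 ltr_wpDr//.
    by rewrite mulr_ge0 ?sqr_ge0// subr_ge0; exact/tanh_coef_le/ltW.
  by rewrite mulr_gt0// subr_gt0 coth_coef_lt.
exists m.+1 => N mN; rewrite diff -[leLHS]add0r lerD//.
  by rewrite mulr_ge0 ?(ltW ab0)// divr_ge0// addr_ge0 ?sqr_ge0.
rewrite ler_pM2r ?invr_gt0// (bigD1 (Ordinal mN))//= lerDl.
exact: sumr_ge0.
Qed.

(** Cauchy-Schwarz for <x, x> = <K^(-1/2) x, K^(1/2) x>, in the factorised form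
    <x, x> = <g, A x> of [adjoint_cvg]. *)
Lemma ip_sq_le_inv_form al x Q : 0 < al -> sqsum x ->
  (forall N, inv_form al x N <= Q) ->
  ip x x ^+ 2 <= Q * qform al x x.
Proof.
move=> al0 sx HQ.
have gE k : (Num.sqrt (wstep al k) * inv_slope al x k) ^+ 2 =
  wstep al k * inv_slope al x k ^+ 2.
  by rewrite exprMn sqr_sqrtr// ltW// wstep_gt0.
have sg : sqsum (fun k => Num.sqrt (wstep al k) * inv_slope al x k).
  by exists Q => N; under eq_bigr do rewrite gE; exact: HQ.
have H := adjoint_cvg al0 sg sx.
have H' : (fun N => \sum_(n < N) x n * x n) @ \oo -->
   ip (fun k => Num.sqrt (wstep al k) * inv_slope al x k) (hardy_op al x).
  by under eq_fun do under eq_bigr do rewrite {1}(sum_inv_slope x _ al0).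
rewrite (ip_unique H').
have sA := sqsum_hardy_op al0 sx.
apply: le_trans (ip_CS sg sA) _; rewrite ler_wpM2r ?ip_ge0//.
by apply: ip_le => // N; under eq_bigr do rewrite gE; exact: HQ.
Qed.

End Monotonicity.

(** * From complex to real eigenvectors *)

Section ComplexSequences.
Variable R : realType.
Local Open Scope complex_scope.

Lemma Kmx_Kentry (a : R) n m : 0 < a -> Kmx a n m = Kentry a n m.
Proof.
move=> a0.
wlog nm : n m / (n <= m)%N.
  move=> H; have [/H //|mn] := leqP n m.
  by rewrite KentryC -H 1?ltnW// /Kmx mulnC maxnC.
rewrite /Kmx /Kentry (minn_idPl nm) (maxn_idPr _) ?ltnS// natrM powRM//.
rewrite -/(npow _ _) -/(npow _ _) -/(npow _ _) npow_double.
have pE k : npow (- 2^-1 + a) k.+1 = (Num.sqrt k.+1%:R)^-1 * npow a k.+1.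
  by rewrite /npow powRD ?powRN ?powR12_sqrt// pnatr_eq0 implybT.
rewrite !pE /vweight; have := npow_gt0 a n; have := npow_gt0 a m.
have := sqrtS_gt0 R n; have := sqrtS_gt0 R m.
move: (Num.sqrt _) (Num.sqrt _) (npow a n.+1) (npow a m.+1) => p q r s p0 q0 r0 s0.
by field; rewrite !gt_eqF.
Qed.

Lemma Re_normc_le (z : R[i]) : `|complex.Re z| <= ComplexField.Normc.normc z.
Proof.
case: z => u v /=; rewrite -sqrtr_sqr ler_wsqrtr// lerDl sqr_ge0//.
Qed.

Lemma Im_normc_le (z : R[i]) : `|complex.Im z| <= ComplexField.Normc.normc z.
Proof.
case: z => u v /=; rewrite -sqrtr_sqr ler_wsqrtr// lerDr sqr_ge0//.
Qed.

Lemma normc_sq (z : R[i]) : ComplexField.Normc.normc z ^+ 2 =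
  complex.Re z ^+ 2 + complex.Im z ^+ 2.
Proof. by case: z => u v /=; rewrite sqr_sqrtr// addr_ge0// sqr_ge0. Qed.

Lemma l2_parts (x : nat -> R[i]) : l2 x ->
  sqsum (fun n => complex.Re (x n)) /\ sqsum (fun n => complex.Im (x n)).
Proof.
move=> cx.
have [B HB] : exists B, forall n, \sum_(k < n) ComplexField.Normc.normc (x k) ^+ 2 <= B.
  exists (limn (series (fun n => ComplexField.Normc.normc (x n) ^+ 2))) => n.
  have := nondecreasing_cvgn_le _ cx n; rewrite /series /= big_mkord; apply.
  by apply: nondecreasing_series => i _ _; exact: sqr_ge0.
by split; exists B => n; apply: le_trans (HB n); apply: ler_sum => k _;
  rewrite normc_sq ?lerDl ?lerDr sqr_ge0.
Qed.

Lemma l2_real (x : nat -> R) : sqsum x -> l2 (fun n => (x n)%:C).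
Proof.
move=> [B HB]; rewrite /l2 /=; apply: nondecreasing_is_cvgn.
  by apply: nondecreasing_series => i _ _; exact: sqr_ge0.
exists B => _ [n _ <-]; rewrite /series [leLHS]big_mkord.
apply: le_trans (HB n); apply: ler_sum => k _.
by rewrite (expr0n _ 2) addr0 sqr_sqrtr ?sqr_ge0.
Qed.

Lemma complex_cvgP (u : nat -> R[i]) (z : R[i]) :
  (u : nat -> R[i]^o) @ \oo --> (z : R[i]^o) <->
  (fun n => complex.Re (u n)) @ \oo --> complex.Re z /\
  (fun n => complex.Im (u n)) @ \oo --> complex.Im z.
Proof.
split.
  move=> /cvgrPdist_lt H.
  have HR (e : R) : 0 < e ->
    \forall n \near \oo, ComplexField.Normc.normc (z - u n) < e.
    move=> e0; have := H (e%:C); rewrite ltcR => /(_ e0).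
    by apply: filterS => n /=; rewrite -ltcR.
  split; apply/cvgrPdist_lt => e /HR; apply: filterS => n; apply: le_lt_trans.
    by rewrite -raddfB; exact: Re_normc_le.
  by rewrite -raddfB; exact: Im_normc_le.
move=> [/cvgrPdist_lt Hr /cvgrPdist_lt Hi]; apply/cvgrPdist_lt => e.
case: e => e f; rewrite ltcE /= => /andP[/eqP -> e0].
have e20 : 0 < e / 2 by rewrite divr_gt0.
have hr := Hr _ e20; have hi := Hi _ e20.
near=> n.
have h1 : `|complex.Re z - complex.Re (u n)| < e / 2 by near: n.
have h2 : `|complex.Im z - complex.Im (u n)| < e / 2 by near: n.
suff : ComplexField.Normc.normc (z - u n) < e by rewrite -ltcR.
rewrite -(@ltr_pXn2r _ 2)// ?nnegrE ?(ltW e0)//; last first.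
  by case: (z - u n) => r s /=; exact: sqrtr_ge0.
rewrite normc_sq !raddfB /=.
have a1 : (complex.Re z - complex.Re (u n)) ^+ 2 < (e / 2) ^+ 2.
  by rewrite -(real_normK (num_real _)) ltr_pXn2r// ?nnegrE// ltW.
have a2 : (complex.Im z - complex.Im (u n)) ^+ 2 < (e / 2) ^+ 2.
  by rewrite -(real_normK (num_real _)) ltr_pXn2r// ?nnegrE// ltW.
have a3 : (e / 2) ^+ 2 + (e / 2) ^+ 2 <= e ^+ 2.
  have -> : (e / 2) ^+ 2 + (e / 2) ^+ 2 = e ^+ 2 / 2 by field.
  by rewrite ler_pdivrMr// ler_peMr ?sqr_ge0// ler1n.
exact: lt_le_trans (ltrD a1 a2) a3.
Unshelve. all: by end_near. Qed.

Lemma Kmaps_parts (a : R) (x y : nat -> R[i]) : Kmaps a x y <->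
  (forall n, (fun N => \sum_(m < N) Kmx a n m * complex.Re (x m)) @ \oo -->
    complex.Re (y n)) /\
  (forall n, (fun N => \sum_(m < N) Kmx a n m * complex.Im (x m)) @ \oo -->
    complex.Im (y n)).
Proof.
have reE n N : complex.Re (\sum_(0 <= m < N) (Kmx a n m)%:C * x m) =
    \sum_(m < N) Kmx a n m * complex.Re (x m).
  rewrite raddf_sum /= big_mkord; apply: eq_bigr => m _.
  by case: (x m) => r s /=; rewrite mul0r subr0.
have imE n N : complex.Im (\sum_(0 <= m < N) (Kmx a n m)%:C * x m) =
    \sum_(m < N) Kmx a n m * complex.Im (x m).
  rewrite raddf_sum /= big_mkord; apply: eq_bigr => m _.
  by case: (x m) => r s /=; rewrite mul0r addr0.
split=> [H|[Hr Hi] n].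
  split=> n; have /complex_cvgP[hr hi] := H n.
    by under eq_fun do rewrite -reE; exact: hr.
  by under eq_fun do rewrite -imE; exact: hi.
apply/complex_cvgP; split; rewrite /series /=.
  by under eq_fun do rewrite reE; exact: Hr.
by under eq_fun do rewrite imE; exact: Hi.
Qed.

(** The matrix is real, so the real and the imaginary part of an eigenvector
    satisfy the same equation and one of them is not zero. *)
Lemma eigenvaluesP (a l : R) : 0 < a -> eigenvalues a l <-> exists x, eigenpair a l x.
Proof.
move=> a0.
have real_case (x : nat -> R) : sqsum x -> x <> 0 ->
    (forall n, (fun N => \sum_(m < N) Kmx a n m * x m) @ \oo --> l * x n) ->
      eigenpair a l x.
  move=> sx x0 H; apply: eigenpair_of_weak => // n; rewrite ip_unit.
  have H2 := qform_unit_cvg a0 sx (n := n).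
  have H3 : (fun N => \sum_(m < N) Kentry a n m * x m) @ \oo --> l * x n.
    by under eq_fun do under eq_bigr do rewrite -Kmx_Kentry//; exact: H.
  exact: (cvg_unique (@norm_hausdorff _ _) H2 H3).
split.
  move=> [x [lx [n0 xn0] /Kmaps_parts[Hr Hi]]].
  have [sr si] := l2_parts lx.
  have lre n : complex.Re (l%:C * x n) = l * complex.Re (x n).
    by case: (x n) => r s /=; rewrite mul0r subr0.
  have lim' n : complex.Im (l%:C * x n) = l * complex.Im (x n).
    by case: (x n) => r s /=; rewrite mul0r addr0.
  have [r0|r0] := pselect ((fun n => complex.Re (x n)) = 0); last first.
    exists (fun n => complex.Re (x n)); apply: real_case => // n.
    by rewrite -lre; exact: Hr.
  exists (fun n => complex.Im (x n)); apply: real_case => // [i0|n]; last first.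
    by rewrite -lim'; exact: Hi.
  move/eqP: xn0; apply; have := congr1 (fun f => f n0) r0;
    have := congr1 (fun f => f n0) i0.
  by rewrite /=; case: (x n0) => r s /= -> ->.
move=> [x ex]; have [sx x0 rx] := ex; exists (fun n => (x n)%:C); split.
- exact: l2_real.
- apply: contra_notP x0 => /forallNP H; apply/funext => n.
  have /negP := H n; rewrite negbK => /eqP.
  by move=> /(congr1 (@complex.Re R)).
- apply/Kmaps_parts; split=> n /=.
    rewrite mul0r subr0; under eq_fun do under eq_bigr do rewrite Kmx_Kentry//.
    have := qform_unit_cvg a0 sx (n := n); rewrite (qform_weak a0 sx rx);
      last exact: sqsum_unit.
    by rewrite ip_unit.
  rewrite mulr0 mul0r addr0.
  rewrite (_ : (fun N => _) = fun=> 0); first exact: cvg_cst.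
  by apply/funext => N; rewrite big1// => k _; rewrite mulr0.
Qed.

End ComplexSequences.

(** * The ordered list of eigenvalues *)

Section EigenvalueList.
Variables (R : realType) (a : R).
Hypothesis a0 : 0 < a.

Lemma eigenvalues_finite : finite_set (eigenvalues a).
Proof.
have [M HM] := finitely_many a0.
apply: contrapT => /(infinite_set_fset M.+1)[B BE cB].
pose lam (i : 'I_M.+1) := nth 0 (enum_fset B) i.
have szi (i : 'I_M.+1) : (i < size (enum_fset B))%N by exact: leq_trans (ltn_ord i) cB.
have /choice[f Hf] : forall i, exists x, eigenpair a (lam i) x.
  by move=> i; apply/eigenvaluesP => //; apply: BE; exact: mem_nth.
have lamI : injective lam.
  move=> i k /eqP; rewrite /lam nth_uniq ?fset_uniq// => /eqP ik; exact: val_inj.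
have := HM _ lam f lamI Hf; rewrite ltnn => H; suff : false by [].
by apply: H => i; exact: eigenvalue_above_threshold (Hf i).
Qed.

Local Notation L := (eigenvalue_list a).

Lemma mem_eigenvalue_list l : (l \in L) <-> exists x, eigenpair a l x.
Proof.
by rewrite -eigenvaluesP// mem_sort in_fset_set ?inE//; exact: eigenvalues_finite.
Qed.

Lemma eigenvalue_list_uniq : uniq L.
Proof. by rewrite sort_uniq fset_uniq. Qed.

Lemma eigenvalue_list_nth_ge i k : (i <= k)%N -> (k < size L)%N ->
  nth 0 L k <= nth 0 L i.
Proof.
move=> ik kL; have sL : sorted >=%O L by apply: sort_sorted => x y; exact: le_total.
have := sorted_leq_nth (fun x y z (h1 : y >= x) (h2 : x >= z) => le_trans h2 h1)
  (@lexx _ R) 0 sL.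
by apply=> //; rewrite inE//; exact: leq_ltn_trans kL.
Qed.

(** Because the list is decreasing. *)
Lemma count_above (c : R) j : (j < size [seq l <- L | (c < l)%R])%N ->
  (j < N_eig a)%N /\ c < eig j.+1 a.
Proof.
move=> H; have jN : (j < size L)%N by apply: leq_trans H _;
  rewrite size_filter count_size.
split=> //; rewrite /eig /= ltNge; apply/negP => Hc.
move: H; rewrite -(cat_take_drop j L) filter_cat size_cat.
have -> : [seq l <- drop j L | c < l] = [::].
  apply/eqP; rewrite -[_ == _]negbK -has_filter; apply/negP => /hasP[l ld].
  have [k kj <-] := elimT (nthP 0) ld; rewrite nth_drop ltNge => /negP; apply.
  rewrite size_drop in kj.
  apply: le_trans Hc; apply: eigenvalue_list_nth_ge; first exact: leq_addr.
  by rewrite -ltn_subRL.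
rewrite addn0 ltnNge => /negP; apply.
by rewrite size_filter; apply: leq_trans (count_size _ _) _;
  rewrite size_take_min geq_minl.
Qed.

(** If there were at most j eigenvalues above c, some nonzero combination of
    the g_i would be orthogonal to their eigenvectors, and [exists_maximizer]
    would give one more eigenvalue above c, with an eigenvector orthogonal to
    the others; this contradicts simplicity. *)
Lemma variational_lower_bound (c : R) j (g : 'I_j.+1 -> nat -> R) : 2 / a <= c ->
  (forall i, sqsum (g i)) ->
  (forall d : 'I_j.+1 -> R, (exists i, d i != 0) ->
     c * ip (\sum_i d i *: g i) (\sum_i d i *: g i) <
     qform a (\sum_i d i *: g i) (\sum_i d i *: g i)) ->
  (j < N_eig a)%N /\ c < eig j.+1 a.
Proof.
move=> c2 sg Hg; apply: count_above; rewrite ltnNge; apply/negP.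
set s := [seq l <- L | c < l]; move=> sj.
pose lam (i : 'I_(size s)) := nth 0 s i.
have lamI : injective lam.
  move=> i k /eqP;
    rewrite /lam nth_uniq ?filter_uniq ?eigenvalue_list_uniq// => /eqP ik.
  exact: val_inj.
have /choice[f Hf] : forall i, exists x, eigenpair a (lam i) x.
  move=> i; apply/mem_eigenvalue_list.
  have : lam i \in s by exact: mem_nth.
  by rewrite mem_filter => /andP[].
have [d d0 Hd] := linear_dependence (fun i m => ip (g i) (f m))
  (sj : (size s < j.+1)%N).
have sx := sqsum_sum d sg.
have sf := family_sqsum Hf.
have px m : ip (\sum_i d i *: g i) (f m) = 0 by rewrite ip_suml.
have [l [x [cl ex pxf]]] := exists_maximizer a0 lamI Hf c2 sx px (Hg d d0).
have ls : l \in s by rewrite mem_filter cl; apply/mem_eigenvalue_list; exists x.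
have [i si nl] := elimT (nthP 0) ls.
pose i' := Ordinal si; have li : lam i' = l by [].
have := Hf i'; rewrite li => fi.
exact: (eigenpair_simple a0 ex fi (pxf i')).
Qed.

Lemma top_eigenvectors j : (j < N_eig a)%N ->
  exists lam : 'I_j.+1 -> R, exists f : 'I_j.+1 -> nat -> R,
    [/\ injective lam, forall i, eigenpair a (lam i) (f i) & forall i, eig j.+1 a <=
      lam i].
Proof.
move=> jN; pose lam (i : 'I_j.+1) := nth 0 L i.
have szi (i : 'I_j.+1) : (i < size L)%N by exact: leq_trans (ltn_ord i) jN.
have /choice[f Hf] : forall i, exists x, eigenpair a (lam i) x.
  by move=> i; apply/mem_eigenvalue_list; exact: mem_nth.
exists lam, f; split=> // [i k /eqP|i].
  rewrite /lam nth_uniq ?eigenvalue_list_uniq// => /eqP; exact: val_inj.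
by apply: eigenvalue_list_nth_ge => //; rewrite -ltnS.
Qed.

Lemma eig_above j : (j < N_eig a)%N -> 2 / a < eig j.+1 a.
Proof.
move=> jN; have : eig j.+1 a \in L by exact: mem_nth.
by move=> /mem_eigenvalue_list[x]; exact: eigenvalue_above_threshold.
Qed.

(** A combination of the first j + 1 eigenvectors whose first j coordinates
    vanish has Rayleigh quotient at least the (j+1)-st eigenvalue, and at most
    1 / (j + 1) + 3 / a by Schur's test. *)
Lemma eig_upper j : (j < N_eig a)%N -> eig j.+1 a <= j.+1%:R^-1 + 3 / a.
Proof.
move=> jN; have [lam [f [lamI ef lamge]]] := top_eigenvectors jN.
have [d d0 Hd] := linear_dependence (fun i (m : 'I_j) => f i m) (ltnSn j).
have sf := family_sqsum ef; have sx := sqsum_sum d sf.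
have xx := family_norm_gt0 a0 lamI ef d0.
have upper := qform_upper (j := j) a0 sx.
rewrite -(ler_pM2r xx); apply: le_trans (upper _) => [|n nj]; last first.
  rewrite fct_sumE; exact: (Hd (Ordinal nj)).
rewrite (qform_family2 a0 lamI ef) (ip_family2 a0 lamI ef) mulr_sumr;
  apply: ler_sum => i _.
rewrite mulrCA ler_wpM2l ?sqr_ge0// ler_wpM2r// ip_ge0//; exact: sf.
Qed.

(** The test space is spanned by the first j + 1 coordinate vectors. The
    constant 4 instead of 3 makes the inequality strict, and the hypothesis on a
    keeps the bound at or above the threshold 2 / a. *)
Lemma eig_lower j : 6 * j.+1%:R <= a ->
  (j < N_eig a)%N /\ j.+1%:R^-1 - 4 / a < eig j.+1 a.
Proof.
move=> ja; have j0 : (0 : R) < j.+1%:R by [].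
apply: (@variational_lower_bound _ _ (fun i => unit_seq R i)).
- rewrite lerBrDr -mulrDl ler_pdivrMr// ler_pdivlMl//.
  by apply: le_trans ja; rewrite mulrC ler_pM2r// -natrD ler_nat.
- by move=> i; exact: sqsum_unit.
- move=> d [i di]; set x := \sum_i _.
  have sx : sqsum x by apply: sqsum_sum => k; exact: sqsum_unit.
  have xE n : x n = \sum_(k < j.+1) d k * (n == k)%:R by rewrite /x fct_sumE.
  have tx : tailseq j.+1 x = 0.
    apply/funext => n; rewrite /tailseq; case: ifP => // jn.
    rewrite xE big1// => k _; rewrite gtn_eqF ?mulr0//.
    exact: leq_trans (ltn_ord k) jn.
  have xx : 0 < ip x x.
    rewrite lt0r ip_ge0// andbT; apply/eqP => ip0; move/eqP: di; apply.
    have x0 : x = 0 by apply: ip_eq0 => //; rewrite ip0.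
    have := congr1 (fun h => h (i : nat)) x0;
      rewrite /= xE (bigD1 i)//= eqxx mulr1 big1 ?addr0//.
    by move=> k ki; rewrite eq_sym (negbTE (ki : (k : nat) != i)) mulr0.
  apply: lt_le_trans (qform_lower a0 sx tx); rewrite ltr_pM2r// ltrD2l ltrN2.
  by rewrite ltr_pM2r ?invr_gt0// ltr_nat.
Qed.

End EigenvalueList.

(** * Comparison of two parameters *)

Section Comparison.
Variable R : realType.

(** Indices are shifted: this is about the (j+1)-st eigenvalue. The test space
    for b is the span of the first j + 1 eigenvectors for a. *)
Lemma eig_compare (a b : R) j : 0 < a -> a < b -> (j < N_eig a)%N ->
  (j < N_eig b)%N /\ a * eig j.+1 a < b * eig j.+1 b.
Proof.
move=> a0 ab jN; have b0 : 0 < b by exact: lt_trans ab.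
have [lam [f [lamI ef lamge]]] := top_eigenvectors a0 jN.
set mu := eig j.+1 a in lamge *.
have mu2 : 2 / a < mu by exact: eig_above.
have mu0 : 0 < mu by apply: lt_trans mu2; rewrite divr_gt0.
have lam0 i : 0 < lam i by exact: lt_le_trans (lamge i).
have sf := family_sqsum ef.
suff [jb Hb] : (j < N_eig b)%N /\ a * mu / b < eig j.+1 b.
  split; first exact: jb.
  by move: (eig _ b) Hb => nu; rewrite ltr_pdivrMr// (mulrC nu).
apply: (@variational_lower_bound _ _ b0 _ _ f) => //.
  by rewrite ler_pM2r ?invr_gt0// mulrC -ler_pdivrMr// ltW.
move=> d d0; set x := \sum_i _.
have xx := family_norm_gt0 a0 lamI ef d0; rewrite -/x in xx.
have sx : sqsum x by exact: sqsum_sum.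
have xn0 : x <> 0 by move=> x0; move: xx; rewrite x0 ip0l ltxx.
(* w = K_a^(-1) x, so that the inverse form at x is the form at w *)
pose w := \sum_i (d i / lam i) *: f i.
have sw : sqsum w by exact: sqsum_sum.
have QQa N : inv_form a x N <= ip x x / mu.
  have ggE n : inv_slope a x n = tail_sum a n w.
    apply: (@inv_slope_unique _ a x (fun n => tail_sum a n w)) => // m.
    rewrite /x fct_sumE /w.
    under [in RHS]eq_bigr do rewrite tail_sum_lincomb// mulr_sumr.
    rewrite exchange_big /= mulr_sumr; apply: eq_bigr => i _.
    have [_ _ ri] := ef i; have lne : lam i != 0 by rewrite gt_eqF.
    have -> : (d i *: f i) m = d i / lam i * (lam i * f i m).
      by rewrite mulrA divfK.
    rewrite ri mulrCA; congr (_ * _); rewrite mulr_sumr.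
    by apply: eq_bigr => k _; rewrite mulrCA.
  have -> : inv_form a x N = \sum_(n < N) hardy_op a w n ^+ 2.
    by apply: eq_bigr => n _; rewrite ggE hardy_op_sq.
  apply: le_trans (le_ip N (sqsum_hardy_op a0 sw)) _.
  rewrite -/(qform a w w) (qform_family2 a0 lamI ef) (ip_family2 a0 lamI ef) mulr_suml.
  apply: ler_sum => i _; have fi0 := eigenpair_norm_gt0 (ef i).
  have -> : (d i / lam i) ^+ 2 * (lam i * ip (f i) (f i)) =
      d i ^+ 2 * ip (f i) (f i) / lam i.
    by field; rewrite gt_eqF.
  apply: ler_wpM2l; first by rewrite mulr_ge0 ?sqr_ge0// ltW.
  by rewrite lef_pV2 ?posrE ?lam0 ?mu0 ?lamge.
have [del del0 [N0 HN0]] := inv_form_antitone a0 ab xn0.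
pose Q := b * (ip x x / mu / a - del).
have inv_form_mono N m : inv_form b x N <= inv_form b x (N + m).
  rewrite /inv_form big_split_ord /= lerDl sumr_ge0// => k _.
  by rewrite mulr_ge0 ?sqr_ge0// ltW// wstep_gt0.
have QQb N : inv_form b x N <= Q.
  apply: le_trans (inv_form_mono N N0.+1) _.
  have := HN0 (N + N0)%N (leq_addl _ _); rewrite addnS -lerBrDr => H.
  rewrite /Q mulrC -ler_pdivrMr//; apply: le_trans H _; rewrite lerD2r.
  by rewrite ler_pM2r ?invr_gt0.
have Q0 : 0 <= Q by have := QQb 0%N; rewrite /inv_form big_ord0.
have main := ip_sq_le_inv_form b0 sx QQb.
rewrite ltNge; apply/negP => Bx.
have := le_trans main (ler_wpM2l Q0 Bx); rewrite leNgt => /negP; apply.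
have -> : Q * (a * mu / b * ip x x) = ip x x ^+ 2 - del * a * mu * ip x x.
  by rewrite /Q; field; rewrite !gt_eqF.
by rewrite gtrBl !mulr_gt0.
Qed.

End Comparison.

Theorem theoremB (R : realType) :
  [/\ forall (j : nat), (1 <= j)%N ->
        forall a b : R, 0 < a -> a < b ->
          (j <= N_eig a)%N -> (j <= N_eig b)%N ->
          a * eig j a < b * eig j b,
      (forall a b : R, 0 < a -> a <= b -> (N_eig a <= N_eig b)%N) /\
      (forall n : nat, exists2 a : R, 0 < a & (n < N_eig a)%N)
    & forall (j : nat), (1 <= j)%N ->
        exists C : R, \forall a \near +oo, `|eig j a - j%:R^-1| <= C * a^-1].
Proof.
split.
- by move=> [|j] // _ a b a0 ab ja _; have [] := eig_compare a0 ab ja.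
- split.
    move=> a b a0; rewrite le_eqVlt => /predU1P[-> //|ab].
    case E : (N_eig a) => [//|j].
    have jN : (j < N_eig a)%N by rewrite E.
    by have [] := eig_compare a0 ab jN.
  move=> n; exists (6 * n.+1%:R); first by rewrite mulr_gt0.
  have a0 : (0 : R) < 6 * n.+1%:R by rewrite mulr_gt0.
  by have [] := eig_lower a0 (lexx _).
- move=> [|j] // _; exists 4; near=> a.
  have aj : 6 * j.+1%:R <= a by near: a; exact: nbhs_pinfty_ge.
  have a0 : 0 < a by apply: lt_le_trans aj; rewrite mulr_gt0.
  have [jN low] := eig_lower a0 aj.
  have up := eig_upper a0 jN.
  rewrite ler_norml; apply/andP; split.
    by rewrite lerBrDl -[X in X <= _]/(_ - _) ltW.
  rewrite lerBlDl; apply: le_trans up _; rewrite lerD2l ler_pM2r ?invr_gt0//.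
  by rewrite ler_nat.
Unshelve. all: by end_near. Qed.
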